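(* For all integers $m\ge1$, the following identities of mod-products symbols hold (as functions of $z$): (i) $S_{2m,m}\big([z]+[1-z]+[1-z^{-1}]\big)\overset{\sqcup\!\sqcup}{=}\sum_{j=1}^{m-1}(-1)^{j+1}\binom{m-1+j}{j}S_{2m+j,m-j}\big([z]+[1-z]+[1-z^{-1}]\big)$; (ii) $S_{2m-1,m}\big([z]+[1-z]\big)\overset{\sqcup\!\sqcup}{=}\sum_{j=1}^{m-1}(-1)^{j+1}\binom{m-2+j}{j}S_{2m-1+j,m-j}\big([z]+[1-z]+\tfrac{j}{m-1}[1-z^{-1}]\big)$; (iii) $S_{2m-2,m}(z)\overset{\sqcup\!\sqcup}{=}\sum_{j=1}^{m-1}(-1)^{j+1}\binom{m-2+j}{j}S_{2m-2+j,m-j}\big([z]-\tfrac{j}{m+j-2}[1-z]-\tfrac{j}{m+j-2}[1-z^{-1}]\big)$.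
   Context: $S_{n,p}(z)=\frac{(-1)^{n+p-1}}{(n-1)!\,p!}\int_0^1\log^{n-1}(t)\log^{p}(1-zt)\frac{dt}{t}$ for $n\ge1,p\ge1$, with the convention $S_{0,p}(z)=\frac{(-1)^p}{p!}\log^p(1-z)$. Functions are extended to formal linear combinations by $f(\sum_j\nu_j[x_j])=\sum_j\nu_jf(x_j)$. Symbols live in $(\mathbb{C}(z)^\times\otimes\mathbb{Q})^{\otimes N}$, written multiplicatively, torsion ignored; the symbol is defined recursively by $\mathrm{Symb}(\log f)=f$, constants of positive weight have symbol $0$, and if $dF=\sum_iF_i\,d\log f_i$ ($F_i$ of weight $N-1$) then $\mathrm{Symb}(F)=\sum_i\mathrm{Symb}(F_i)\otimes f_i$. With $\Pi_1=\mathrm{id}$, $\Pi_N(a_1\otimes\cdots\otimes a_N)=\frac{N-1}{N}\big(\Pi_{N-1}(a_1\otimes\cdots\otimes a_{N-1})\otimes a_N-\Pi_{N-1}(a_2\otimes\cdots\otimes a_N)\otimes a_1\big)$, the mod-products symbol is $\mathrm{Symb}^{\sqcup\!\sqcup}=N\Pi_N\circ\mathrm{Symb}$ in weight $N$, and $f\overset{\sqcup\!\sqcup}{=}g$ means $\mathrm{Symb}^{\sqcup\!\sqcup}f=\mathrm{Symb}^{\sqcup\!\sqcup}g$.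
   Formalization: Identity (iii) is stated only for m ≥ 2: at m = 1 its sum is empty and it would say that S_{0,1}(z) = −log(1−z), of weight 1 with Π_1 = id, has zero mod-products symbol, which is false. *)

(* Defs.v *)
From HB Require Import structures.
From mathcomp Require Import all_boot all_order all_algebra.
From mathcomp Require Import complex freeg.
From mathcomp Require Import all_classical all_reals all_analysis.

Set Implicit Arguments.
Unset Strict Implicit.
Unset Printing Implicit Defensive.

Import Order.TTheory GRing.Theory Num.Theory.
Import numFieldNormedType.Exports.

Local Open Scope classical_set_scope.
Local Open Scope ring_scope.
Local Open Scope complex_scope.

Section Nielsen.
Variable R : realType.
Implicit Types (z x : R[i]).

(* The principal logarithm on the plane slit along the nonpositive reals:
   the half-angle formula [tan (arg z / 2) = Im z / (|z| + Re z)] gives the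
   argument in ]-pi, pi[.  Values on the slit are meaningless. *)
Definition Clog z : R[i] :=
  let r := Num.sqrt (complex.Re z ^+ 2 + complex.Im z ^+ 2) in
  ln r +i* (2 * atan (complex.Im z / (r + complex.Re z))).

Definition Cintegral01 (f : R -> R[i]) : R[i] :=
  (\int[lebesgue_measure]_(t in `[0%R, 1%R]) complex.Re (f t)) +i*
  (\int[lebesgue_measure]_(t in `[0%R, 1%R]) complex.Im (f t)).

(* [S_{n,p}(z)], on the principal branch, for [p >= 1] and [z] outside
   [1, +oo[; the integrand is then Lebesgue integrable on [0, 1]. *)
Definition nielsen (n p : nat) z : R[i] :=
  if n == 0%N then (-1) ^+ p / (p`!)%:R * Clog (1 - z) ^+ p
  else (-1) ^+ (n + p - 1)%N / ((n - 1)`! * p`!)%:R *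
       Cintegral01 (fun t =>
         (ln t)%:C ^+ (n - 1)%N * Clog (1 - z * t%:C) ^+ p / t%:C).

Definition pt z : {freeg R[i] / rat} := << z >>.

Definition formal_ext (f : R[i] -> R[i]) (D : {freeg R[i] / rat}) : R[i] :=
  \sum_(x <- dom D) ratr (coeff x D) * f x.

(* A common domain of holomorphy of [z], [1 - z] and [1 - z^-1] substituted
   in the principal branches: the plane minus ]-oo, 0] and [1, +oo[.  The
   order on [R[i]] is partial: [z <= 0] means that [z] is a nonpositive real. *)
Definition cut_plane : set R[i] := [set z | ~~ (z <= 0) && ~~ (1 <= z)].

End Nielsen.

Section Symbols.
Variable R : realType.

Definition ratfun := {fraction {poly R[i]}}.

Definition letter := {f : ratfun | f != 0}.

(* Representatives of elements of the tensor algebra over [rat] of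
   [C(z)^* (x) Q]: formal combinations of words [a_1 (x) ... (x) a_N]. *)
Definition words := {freeg (seq letter) / rat}.

(* The subspace of relations expressing additivity in each slot, [C(z)^*]
   being written multiplicatively.  Torsion dies since coefficients are
   rational. *)
Inductive multilin_rel : words -> Prop :=
| multilin_rel0 : multilin_rel 0
| multilin_relD (q : rat) (u v : seq letter) (f g h : letter) (s : words) of
    val h = val f * val g & multilin_rel s :
    multilin_rel
      (q *: (<< u ++ h :: v >> - << u ++ f :: v >> - << u ++ g :: v >>) + s).

Definition tensor_eq (s t : words) : Prop := multilin_rel (s - t).

Definition tensor_rcons (s : words) (f : letter) : words :=
  fglift (fun w => << rcons w f >> : words) s.

(* [g] is [d log f / dz] on [U], where [f] has neither zeros nor poles. *)
Definition is_dlog (U : set R[i]) (f : letter) (g : R[i] -> R[i]) : Prop :=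
  exists p q : {poly R[i]}, val f = tofrac p / tofrac q /\
    forall z, U z -> [/\ p.[z] != 0, q.[z] != 0 &
      g z = p^`().[z] / p.[z] - q^`().[z] / q.[z]].

(* [is_symb U N F s]: [s] represents the symbol of the weight [N] function
   [F] on the domain [U].  Functions of weight 0 are the rational constants;
   [Symb (log f) = f] and [Symb c = 0] for constants [c] of positive weight
   are then instances of the recursion, see [is_symb_log] and [is_symb_cst].
   Since nonzero constant functions are letters with [d log = 0], the symbol
   is determined only up to words having a constant letter. *)
Inductive is_symb (U : set R[i]) : nat -> (R[i] -> R[i]) -> words -> Prop :=
| is_symb0 (q : rat) (F : R[i] -> R[i]) of
    (forall z, U z -> F z = ratr q) :
    is_symb U 0 F << q *g [::] >>
| is_symbS (N n : nat) (F : R[i] -> R[i]) (G : 'I_n -> R[i] -> R[i])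
    (s : 'I_n -> words) (f : 'I_n -> letter) (df : 'I_n -> R[i] -> R[i]) of
    (forall i, is_symb U N (G i) (s i)) &
    (forall i, is_dlog U (f i) (df i)) &
    (forall z, U z ->
       is_derive (z : R[i]^o) 1 (F : R[i]^o -> R[i]^o)
         (\sum_(i < n) G i z * df i z)) :
    is_symb U N.+1 F (\sum_(i < n) tensor_rcons (s i) (f i)).

(* [Pi_word N w] is [Pi_N] of a word [w] of length [N]. *)
Fixpoint Pi_word (N : nat) (w : seq letter) : words :=
  match N, w with
  | 1, [:: a] => << [:: a] >>
  | M.+1, a :: w' =>
      (M%:R / M.+1%:R) *:
        (tensor_rcons (Pi_word M (belast a w')) (last a w')
         - tensor_rcons (Pi_word M w') a)
  | _, _ => 0
  end.

Definition mod_products (N : nat) (s : words) : words :=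
  fglift (fun w => N%:R *: Pi_word N w) s.

Definition mod_products_eq (U : set R[i]) (N : nat) (F G : R[i] -> R[i]) :=
  exists s t : words, [/\ is_symb U N F s, is_symb U N G t &
    tensor_eq (mod_products N s) (mod_products N t)].

Lemma is_symb_log (U : set R[i]) (f : letter) (df F : R[i] -> R[i]) :
  is_dlog U f df ->
  (forall z, U z -> is_derive (z : R[i]^o) 1 (F : R[i]^o -> R[i]^o) (df z)) ->
  is_symb U 1 F << [:: f] >>.
Proof.
move=> fdf dF.
have -> : << [:: f] >> =
    \sum_(i < 1) tensor_rcons (<< 1 *g [::] >> : words) f :> words.
  by rewrite big_ord1 /tensor_rcons liftU scale1r.
apply: (@is_symbS U 0 1 F (fun _ _ => 1) _ (fun _ => f) (fun _ => df)) => //.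
- by move=> _; apply: is_symb0 => z _; rewrite rmorph1.
- by move=> z Uz; rewrite big_ord1 mul1r; exact: dF.
Qed.

Lemma is_symb_cst (U : set R[i]) (N : nat) (c : R[i]) :
  is_symb U N.+1 (fun=> c) 0.
Proof.
have -> : 0 = \sum_(i < 0) tensor_rcons (0 : words) (exist _ 1 (oner_neq0 _))
  by rewrite big_ord0.
apply: (@is_symbS U N 0 _ (fun _ _ => 0) _ _ (fun _ _ => 0)) => [[]//|[]//|z _].
by rewrite big_ord0; exact: is_derive_cst.
Qed.

End Symbols.

(* Main.v *)
(* On the cut plane everything has a symbol on the two letters X = z and
   Y = 1 - z, and 1 - 1/z contributes Y - X, so no multilinearity relation is
   needed: up to the sign (-1)^p, the symbols of S_{n,p} at z, 1 - z and
   1 - 1/z are Y^p X^n, X^p Y^n and (-1)^p X^p (Y - X)^n.  The mod-products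
   map rho = N Pi_N satisfies rho(a w b) = rho(a w) b - rho(w b) a.  Putting
   e(k, l) = rho(X^k Y^l), this recursion gives
   rho(Y^p X^n) = (-1)^(n+p-1) e(n, p) and
   rho(X^p (Y - X)^n) = sum_(k >= 1) C(k-1, p-1) e(k, n+p-k),
   so that each identity reduces to scalar binomial identities, one for each
   e(k, N-k), which say that (1+t)^(-a-1) (1+t)^k = (1+t)^(k-a-1).

   The differential equation z S_{n+1,p}' = S_{n,p} is obtained by
   differentiating under the integral sign, with a quadratic remainder
   bounded uniformly in t, followed by an integration by parts on ]0, 1]. *)

Require Import Defs.
From HB Require Import structures.
From mathcomp Require Import all_boot all_order all_algebra.
From mathcomp Require Import complex freeg.
From mathcomp Require Import all_classical all_reals all_analysis.
From mathcomp Require Import measurable_realfun ring lra zify.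

Set Implicit Arguments.
Unset Strict Implicit.
Unset Printing Implicit Defensive.

Import Order.TTheory GRing.Theory Num.Theory.
Import numFieldNormedType.Exports.

Local Open Scope classical_set_scope.
Local Open Scope ring_scope.
Local Open Scope complex_scope.

(** * Linear extension from the basis of a free module *)

Section FreeModules.
Variables (G : nzRingType) (K : choiceType) (M : lmodType G) (f : K -> M).

(** The recursion for rho only removes outermost letters, so it closes up on words made of one pure
    block at each end. The words X^k Y^l form such a family, and so do the X^p (Y - X)^n once Y - X
    is handled as one formal letter. Powers of a single letter of length at least 2 are killed, so
    the only pure powers with a nonzero image are e(1, 0) and e(0, 1).

    In the scalar identities, (1+t)^(-a-1) is the generating series of the alternating coefficients
    (-1)^j C(a+j, j), and (1+t)^k that of the binomials in the expansion of rho(X^p (Y - X)^n). The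
    rational weights j/(m-1) and j/(m+j-2) turn C(m-2+j, j) into C(m-2+j, j-1) and C(m-3+j, j-1):
    these are again such coefficients, with a = m-1 and a = m-2, for the index j-1.

    On the analytic side the obstacle is the endpoint t = 0, where both 1/t and the powers of ln t
    are unbounded. The logarithm of 1 - zt and its quadratic remainder in z are O(t), which absorbs
    1/t; the powers of ln t that remain are dominated by a multiple of t^(-1/2). *)

Lemma freegZU (c k : G) (a : K) : c *: << k *g a >> = << (c * k) *g a >>.
Proof. by apply/eqP/freeg_eqP => b; rewrite coeffZ !coeffU mulrA. Qed.

HB.instance Definition _ :=
  GRing.isAdditive.Build {freeg K / G} M (fglift f) (lift_is_additive f).

Lemma fglift_scalable : scalable (fglift f).
Proof.
move=> c D; have E := freeg_sumE D.
have -> : c *: D = \sum_(a <- dom D) << c * coeff a D *g a >>.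
  rewrite -[in LHS]E; apply: etrans (scaler_sumr _ _ _ _) _.
  by apply: eq_bigr => a _; rewrite freegZU.
have -> : fglift f D = \sum_(a <- dom D) coeff a D *: f a.
  rewrite -[in LHS]E; apply: etrans (raddf_sum _ _ _ _) _.
  by apply: eq_bigr => a _; rewrite /= liftU.
rewrite scaler_sumr; apply: etrans (raddf_sum _ _ _ _) _.
by apply: eq_bigr => a _; rewrite /= liftU scalerA.
Qed.

HB.instance Definition _ :=
  GRing.isScalable.Build G {freeg K / G} M *:%R (fglift f) fglift_scalable.

(** Reduces operator identities on formal combinations of words to single words. *)
Lemma freeg_linear_ext (g h : {linear {freeg K / G} -> M}) :
  (forall a, g << a >> = h << a >>) -> g =1 h.
Proof.
move=> gh D; rewrite -(freeg_sumE D).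
apply: etrans (raddf_sum _ _ _ _) _; apply/esym.
apply: etrans (raddf_sum _ _ _ _) _; apply: eq_bigr => a _.
rewrite -[coeff a D]mulr1 -freegZU; apply: etrans (linearZ_LR h _ _) _.
by apply/esym; apply: etrans (linearZ_LR g _ _) _; rewrite gh.
Qed.

End FreeModules.

(** * The recursion of the mod-products map *)

Section TensorWords.
Variable R : realType.
Local Notation letter := (letter R).
Local Notation words := (words R).
Implicit Types (x y : letter) (s : words).

(* [trcons x s] is [tensor_rcons s x] and [mprod] is [mod_products], in a form
   for which linearity can be inferred. *)
Definition tcons x : words -> words := fglift (fun w => << x :: w >>).
Definition trcons x : words -> words := fglift (fun w => << rcons w x >>).
Definition mprod N : words -> words := fglift (fun w => N%:R *: Pi_word N w).

HB.instance Definition _ x := GRing.Linear.on (tcons x).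
HB.instance Definition _ x := GRing.Linear.on (trcons x).
HB.instance Definition _ N := GRing.Linear.on (mprod N).

Lemma trconsZ x q s : trcons x (q *: s) = q *: trcons x s. Proof. exact: linearZ_LR. Qed.
Lemma mprodZ N q s : mprod N (q *: s) = q *: mprod N s. Proof. exact: linearZ_LR. Qed.

Lemma tconsU x w : tcons x << w >> = << x :: w >>.
Proof. by rewrite /tcons liftU scale1r. Qed.

Lemma trconsU x w : trcons x << w >> = << rcons w x >>.
Proof. by rewrite /trcons liftU scale1r. Qed.

Lemma mprodU N w : mprod N << w >> = N%:R *: Pi_word N w.
Proof. by rewrite /mprod liftU scale1r. Qed.

Lemma Pi_wordSS N x w : Pi_word N.+2 (x :: w) =
  (N.+1%:R / N.+2%:R) *: (trcons (last x w) (Pi_word N.+1 (belast x w))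
                          - trcons x (Pi_word N.+1 w)).
Proof. by []. Qed.

Lemma tcons_trcons x y s : tcons x (trcons y s) = trcons y (tcons x s).
Proof.
apply: (freeg_linear_ext (g := tcons x \o trcons y) (h := trcons y \o tcons x)) => w /=.
by rewrite trconsU !tconsU trconsU.
Qed.

(** The normalisation N Pi_N clears the denominators: N+2 times (N+1)/(N+2) is N+1, the factor
    carried by both terms of lower weight. No condition on word lengths arises, since [Pi_word]
    recurses on its weight argument and inspects only the two ends. *)
Lemma mprod_rec N x y s :
  mprod N.+2 (tcons x (trcons y s)) =
  trcons y (mprod N.+1 (tcons x s)) - trcons x (mprod N.+1 (trcons y s)).
Proof.
pose g := trcons y \o mprod N.+1 \o tcons x.
pose h := trcons x \o mprod N.+1 \o trcons y.
have := freeg_linear_ext (g := mprod N.+2 \o tcons x \o trcons y) (h := g \- h).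
apply => w; rewrite {}/g {}/h.
change (mprod N.+2 (tcons x (trcons y << w >>)) =
  trcons y (mprod N.+1 (tcons x << w >>)) - trcons x (mprod N.+1 (trcons y << w >>))).
rewrite !trconsU !tconsU !mprodU Pi_wordSS belast_rcons last_rcons !trconsZ.
rewrite scalerA mulrCA divff ?pnatr_eq0 // mulr1 -scalerBr.
by congr (_ *: _).
Qed.

End TensorWords.

(** * Images of X^k Y^l and X^p (Y - X)^n under the mod-products map *)

Section TwoLetterWords.
Variable R : realType.
Local Notation letter := (letter R).
Local Notation words := (words R).
Implicit Types (x y : letter) (s : words).

Lemma trconsD x s t : trcons x (s + t) = trcons x s + trcons x t. Proof. exact: raddfD. Qed.
Lemma mprodD N s t : mprod N (s + t) = mprod N s + mprod N t :> words.
Proof. exact: raddfD. Qed.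
Lemma tconsB x s t : tcons x (s - t) = tcons x s - tcons x t. Proof. exact: raddfB. Qed.
Lemma trconsB x s t : trcons x (s - t) = trcons x s - trcons x t. Proof. exact: raddfB. Qed.
Lemma mprodB N s t : mprod N (s - t) = mprod N s - mprod N t :> words.
Proof. exact: raddfB. Qed.
Lemma trcons0 x : trcons x 0 = 0 :> words. Proof. exact: raddf0. Qed.
Lemma trcons_sum x (I : Type) (r : seq I) (P : pred I) (F : I -> words) :
  trcons x (\sum_(i <- r | P i) F i) = \sum_(i <- r | P i) trcons x (F i).
Proof. exact: raddf_sum. Qed.
Lemma mprod_sum N (I : Type) (r : seq I) (P : pred I) (F : I -> words) :
  mprod N (\sum_(i <- r | P i) F i) = \sum_(i <- r | P i) mprod N (F i).
Proof. exact: raddf_sum. Qed.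

Definition word0 : words := << [::] >>.

(* [mono x y k l] is X^k Y^l and [diff_mono x y p n] is X^p (Y - X)^n. *)
Definition mono x y k l : words := iter k (tcons x) (iter l (trcons y) word0).

(** Right and left multiplication by Y - X, the additive expansion of the letter (1 - z)/z. *)
Definition rdiff x y s : words := trcons y s - trcons x s.
Definition ldiff x y s : words := tcons y s - tcons x s.

Definition diff_mono x y p n : words := iter p (tcons x) (iter n (rdiff x y) word0).

(* [emono x y k l] is e(k, l) in the header. *)
Definition emono x y k l := mprod (k + l) (mono x y k l).
Definition ediff x y p n := mprod (p + n) (diff_mono x y p n).

Lemma iter_tcons_trcons x y k s : iter k (tcons x) (trcons y s) = trcons y (iter k (tcons x) s).
Proof. by elim: k => //= k ->; rewrite tcons_trcons. Qed.

Lemma iter_tcons_rdiff x y z k s :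
  iter k (tcons z) (rdiff x y s) = rdiff x y (iter k (tcons z) s).
Proof. by elim: k => //= k ->; rewrite /rdiff tconsB !tcons_trcons. Qed.

Lemma iter_trcons_word0 x n : iter n (trcons x) word0 = iter n (tcons x) word0.
Proof.
elim: n => //= n IH; rewrite IH -iter_tcons_trcons -iterS iterSr /word0.
by rewrite trconsU tconsU.
Qed.

Lemma emono_rec x y k l :
  emono x y k.+1 l.+1 = trcons y (emono x y k.+1 l) - trcons x (emono x y k l.+1).
Proof.
rewrite /emono /mono /= !iter_tcons_trcons !addnS mprod_rec; exact: erefl.
Qed.

(** On a power of a single letter the two terms of the recursion coincide. The length must be at
    least 2: e(1, 0) is X itself. *)
Lemma emono_n0 x y n : emono x y n.+2 0 = 0.
Proof.
rewrite /emono /mono /= addn0 -iterS -iter_trcons_word0 /= tcons_trcons.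
rewrite -tcons_trcons mprod_rec; rewrite -[trcons x (iter n _ _)]/(iter n.+1 (trcons x) word0).
by rewrite !iter_trcons_word0 subrr.
Qed.

Lemma emono_0n x y n : emono x y 0 n.+2 = 0.
Proof.
rewrite /emono /mono add0n iter_trcons_word0.
by have := emono_n0 y y n; rewrite /emono addn0.
Qed.

Lemma emono00 x y : emono x y 0 0 = 0.
Proof. by rewrite /emono mprodU /= scaler0. Qed.

(** An instance of the reversal rule: reading a word of length N backwards multiplies its image by
    (-1)^(N-1), because the two terms of the recursion are exchanged. *)
Lemma emono_sym x y p n : emono y x p n = (-1) ^+ (p + n).+1 *: emono x y n p.
Proof.
elim: p n => [|p IHp] n.
  case: n => [|[|n]]; rewrite ?emono00 ?scaler0 ?emono_0n ?emono_n0 ?scaler0 //.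
  by rewrite /= sqrrN expr1n scale1r /emono /mono /= /word0 trconsU tconsU.
elim: n => [|n IHn].
  case: p {IHp} => [|n]; rewrite ?emono_0n ?emono_n0 ?scaler0 //.
  by rewrite /= sqrrN expr1n scale1r /emono /mono /= /word0 trconsU tconsU.
rewrite emono_rec IHn IHp emono_rec !trconsZ !addSn !addnS -scalerBr.
by rewrite [in RHS]exprS mulN1r scaleNr -scalerN opprB.
Qed.

(** The recursion is linear in each outer letter, so it persists with Y - X as the last letter;
    [mprod_rec_ldiff] has it at both ends. *)
Lemma mprod_rec_rdiff N x y z s : mprod N.+2 (tcons z (rdiff x y s)) =
  rdiff x y (mprod N.+1 (tcons z s)) - trcons z (mprod N.+1 (rdiff x y s)).
Proof.
rewrite /rdiff tconsB mprodB !mprod_rec mprodB trconsB.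
by apply/eqP/freeg_eqP => w; rewrite !(coeffB, coeffD, coeffN); ring.
Qed.

Lemma mprod_rec_ldiff N x y s : mprod N.+2 (ldiff x y (rdiff x y s)) =
  rdiff x y (mprod N.+1 (ldiff x y s)) - rdiff x y (mprod N.+1 (rdiff x y s)).
Proof.
rewrite [ldiff x y _]/ldiff mprodB !mprod_rec_rdiff /ldiff mprodB.
rewrite [rdiff x y (_ - _)]/rdiff [rdiff x y (mprod _ (rdiff _ _ _))]/rdiff.
by rewrite !trconsB; apply/eqP/freeg_eqP => w; rewrite !(coeffB, coeffD, coeffN); ring.
Qed.

Lemma ldiff_rdiff x y s : ldiff x y (rdiff x y s) = rdiff x y (ldiff x y s).
Proof.
rewrite /ldiff /rdiff !tconsB !trconsB !tcons_trcons.
by apply/eqP/freeg_eqP => w; rewrite !coeffB; ring.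
Qed.

Lemma iter_rdiff_word0 x y n :
  ldiff x y (iter n (rdiff x y) word0) = iter n.+1 (rdiff x y) word0.
Proof.
elim: n => [|n IH]; first by rewrite /ldiff /rdiff /word0 /= !trconsU !tconsU.
by rewrite iterS [RHS]iterS -IH ldiff_rdiff.
Qed.

(** For n >= 1 both sides vanish, the left one because Y - X acts as a single letter; for n = 0 both
    are Y - X. In this form the two terms match the end terms of the shifted sums in the case p = 0
    of [ediffE]. *)
Lemma ediff_0n x y n : ediff x y 0 n.+1 = emono x y 0 n.+1 - emono x y n.+1 0.
Proof.
case: n => [|n].
  by rewrite /ediff /emono /= /diff_mono /mono /= /rdiff /word0 mprodB tconsU !trconsU.
rewrite emono_0n emono_n0 subr0 /ediff /diff_mono add0n /=.
rewrite -[rdiff x y (iter n _ _)]/(iter n.+1 (rdiff x y) word0).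
rewrite -iter_rdiff_word0 -ldiff_rdiff mprod_rec_ldiff iter_rdiff_word0.
exact: subrr.
Qed.

Lemma ediff_rec x y p n : ediff x y p.+1 n.+1 =
  rdiff x y (ediff x y p.+1 n) - trcons x (ediff x y p n.+1).
Proof.
by rewrite /ediff /diff_mono /= !iter_tcons_rdiff !addnS mprod_rec_rdiff; exact: erefl.
Qed.

(** Induction on n, then on p, through [ediff_rec]. The terms ending in Y reproduce the sum by
    [emono_rec], and those ending in X match by Pascal's rule on C(k, p). *)
Lemma ediffE x y p n : ediff x y p.+1 n =
  \sum_(0 <= k < (p + n).+1) 'C(k, p)%:R *: emono x y k.+1 (p + n - k).
Proof.
elim: n p => [|n IHn] p.
  rewrite addn0 big_nat_recr //= subnn binn scale1r big_nat big1 ?add0r //.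
  by move=> k /andP[_ kp]; rewrite bin_small // scale0r.
elim: p => [|p IHp]; rewrite ediff_rec IHn.
  rewrite ediff_0n !add0n.
  rewrite [RHS]big_nat_recr //= subnn emono_n0 scaler0 addr0.
  rewrite /rdiff !trcons_sum trconsB.
  have -> : \sum_(0 <= k < n.+1) 'C(k, 0)%:R *: emono x y k.+1 (n.+1 - k) =
     \sum_(0 <= k < n.+1) trcons y ('C(k, 0)%:R *: emono x y k.+1 (n - k)) -
     \sum_(0 <= k < n.+1) trcons x (emono x y k (n.+1 - k)).
    rewrite -sumrB; apply: eq_big_nat => k /andP[_ kn].
    by rewrite !bin0 !scale1r subSn // emono_rec.
  rewrite [X in _ = _ - X]big_nat_recl // subn0.
  have -> : \sum_(0 <= k < n.+1) trcons x ('C(k, 0)%:R *: emono x y k.+1 (n - k)) =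
    \sum_(0 <= k < n) trcons x (emono x y k.+1 (n.+1 - k.+1)) + trcons x (emono x y n.+1 0).
    rewrite big_nat_recr // subnn bin0 scale1r; congr (_ + _).
    by apply: eq_big_nat => k _; rewrite bin0 scale1r subSS.
  by apply/eqP/freeg_eqP => w; rewrite !(coeffB, coeffD, coeffN); ring.
rewrite IHp -!addSnnS !addSn.
rewrite [RHS]big_nat_recr //= subnn emono_n0 scaler0 addr0.
have -> : \sum_(0 <= k < (p + n).+2) 'C(k, p.+1)%:R *: emono x y k.+1 ((p + n).+2 - k) =
     \sum_(0 <= k < (p + n).+2) trcons y ('C(k, p.+1)%:R *: emono x y k.+1 ((p + n).+1 - k)) -
     \sum_(0 <= k < (p + n).+2) 'C(k, p.+1)%:R *: trcons x (emono x y k ((p + n).+2 - k)).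
  rewrite -sumrB; apply: eq_big_nat => k /andP[_ kn].
  by rewrite trconsZ -scalerBr [in LHS]subSn // emono_rec -subSn.
rewrite /rdiff !trcons_sum -[RHS]addr0 -!addrA; congr (_ + _).
rewrite -opprD addr0; congr (- _).
rewrite -big_split /= [RHS]big_nat_recl // bin0n scale0r add0r.
rewrite big_nat_recr //= subnn emono_n0 !scaler0 !trcons0 !addr0.
by apply: eq_big_nat => k _; rewrite !trconsZ -scalerDl -natrD -binS subSS.
Qed.

End TwoLetterWords.

(* Both sides are the coefficient of [t ^ b] in [(1 + t) ^ (k - a - 1)]. *)
Lemma sum_bin_sign (a b k : nat) :
  \sum_(0 <= i < b.+1) (-1) ^+ i * 'C(a + i, i)%:R * 'C(k, b - i)%:R =
  (if (k <= a)%N then (-1) ^+ b * 'C(a - k + b, b)%:R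
   else 'C(k - a.+1, b)%:R) :> rat.
Proof.
elim: k b => [|k IH] b.
  rewrite leq0n subn0 big_nat_recr //= subnn bin0 mulr1 big_nat big1 ?add0r //.
  by move=> i /andP[_ ib]; rewrite bin0n subn_eq0 leqNgt ib mulr0.
case: b => [|b].
  by rewrite big_nat1 /= !expr0 !bin0 !mulr1; case: ifP.
rewrite big_nat_recr //= subnn bin0 mulr1.
(* Pascal's rule on the second binomial is multiplication of the generating series by 1 + t. *)
under eq_big_nat => i /andP[_ ib].
  rewrite subSn // binS natrD mulrDr -subSn //. over.
rewrite big_split /= IH addrAC.
have -> : \sum_(0 <= i < b.+1) (-1) ^+ i * 'C(a + i, i)%:R * 'C(k, b.+1 - i)%:R
   + (-1) ^+ b.+1 * 'C(a + b.+1, b.+1)%:R = 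
   \sum_(0 <= i < b.+2) (-1) ^+ i * 'C(a + i, i)%:R * 'C(k, b.+1 - i)%:R :> rat.
  by rewrite [RHS]big_nat_recr //= subnn bin0 mulr1.
(* The exponent k - a - 1 becomes k - a: it stays negative, stays nonnegative, or goes from -1 to 0,
   where every coefficient of positive degree cancels. *)
rewrite IH; case: (ltngtP k a) => ka.
- have -> : (a - k + b.+1 = (a - k.+1 + b.+1).+1)%N by lia.
  rewrite binS natrD exprS; have -> : (a - k + b = a - k.+1 + b.+1)%N by lia.
  by rewrite mulN1r mulrDr -addrA -mulrDl addNr mul0r addr0.
- have -> : (k.+1 - a.+1 = (k - a.+1).+1)%N by lia.
  by rewrite binS natrD.
- by rewrite ka !subnn !add0n !binn bin0n exprS !mulr1 mulN1r addNr.
Qed.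

(** * The three identities between the elements e(k, l) *)

Section ModProductIdentities.
Variables (R : realType) (x y : letter R).
Local Notation words := (words R).

(** All terms have weight M+b+1, so by [ediffE] the coefficient of each e(k+1, M+b-k) is one
    alternating binomial sum. It vanishes for a < k <= a+b, where the polynomial (1+t)^(k-a-1) has
    degree below b; the ranges k <= a and k > a+b give the two sums on the right. *)
Lemma sum_ediff (a b M : nat) : (a <= M)%N ->
  \sum_(0 <= i < b.+1) ((-1) ^+ i * 'C(a + i, i)%:R) *: ediff x y (b.+1 - i) (M + i)
  = \sum_(0 <= i < a.+1)
      ((-1) ^+ b * 'C(b + i, i)%:R) *: emono x y (a.+1 - i) (M + b - a + i)
    + \sum_(0 <= j < M - a)
        'C(b + j, j)%:R *: emono x y (a + b + 2 + j) (M - a - 1 - j).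
Proof.
move=> aM.
pose B k : rat := if (k <= a)%N then (-1) ^+ b * 'C(a - k + b, b)%:R
   else 'C(k - a.+1, b)%:R.
transitivity (\sum_(0 <= k < (M + b).+1) B k *: emono x y k.+1 (M + b - k)).
  transitivity (\sum_(0 <= i < b.+1) \sum_(0 <= k < (M + b).+1)
    ((-1) ^+ i * 'C(a + i, i)%:R * 'C(k, b - i)%:R) *: emono x y k.+1 (M + b - k)).
    apply: eq_big_nat => i /andP[_ ib].
    rewrite subSn // ediffE; have -> : (b - i + (M + i) = M + b)%N by lia.
    by rewrite scaler_sumr; apply: eq_big_nat => k _; rewrite scalerA.
  rewrite exchange_big_nat /=; apply: eq_big_nat => k _.
  by rewrite /B -sum_bin_sign scaler_suml.
rewrite (big_cat_nat (n := a.+1)) //=; last by lia.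
congr (_ + _).
  rewrite big_nat_rev; apply: eq_big_nat => i /andP[_ ia].
  have -> : (0 + a.+1 - i.+1 = a - i)%N by lia.
  rewrite /B leq_subr; have -> : (a - (a - i) = i)%N by lia.
  congr (_ *: emono _ _ _ _); [|by lia|by lia].
  by rewrite addnC -[in RHS]bin_sub ?leq_addl // addnK.
have -> : a.+1 = (0 + a.+1)%N by [].
rewrite big_addn (big_cat_nat (n := b)) //=; last by lia.
rewrite big_nat big1 ?add0r; last first.
  move=> k /andP[_ kb]; rewrite /B ifF; last by lia.
  by rewrite addnK bin_small // scale0r.
have -> : (b = 0 + b)%N by [].
rewrite big_addn; have -> : ((M + b).+1 - (0 + a.+1) - b = M - a)%N by lia.
apply: eq_big_nat => j /andP[_ ja]; rewrite /B ifF; last by lia.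
congr (_ *: emono _ _ _ _); [|by lia|by lia].
have -> : (j + b + (0 + a.+1) - a.+1 = b + j)%N by lia.
by rewrite -[in RHS]bin_sub ?leq_addl // addnK.
Qed.

Lemma eq_sign (i j : nat) : odd i = odd j -> (-1) ^+ i = (-1) ^+ j :> rat.
Proof. by move=> ij; rewrite -signr_odd ij signr_odd. Qed.

(** Identity (i) for m = b+1, brought to one side with its left-hand function as the term j = 0.
    [sum_ediff] with a = b and M = 2m cancels everything up to one surplus term, a pure power of
    X. *)
Lemma mod_products_id1 b :
  \sum_(0 <= j < b.+1) ((-1) ^+ j * 'C(b + j, j)%:R) *:
    ((-1) ^+ (2 * b + 2 + j).+1 *: emono x y (2 * b + 2 + j) (b.+1 - j)
     + (-1) ^+ (b.+1 - j) *: emono x y (b.+1 - j) (2 * b + 2 + j)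
     + ediff x y (b.+1 - j) (2 * b + 2 + j)) = 0.
Proof.
under eq_big_nat => j /andP[_ jb].
  rewrite !scalerDr; over.
rewrite 2!big_split /= sum_ediff; last by lia.
have -> : (2 * b + 2 - b = b.+2)%N by lia.
rewrite [X in _ + (_ + X)]big_nat_recr //=.
have -> : (b.+2 - 1 - b.+1 = 0)%N by lia.
rewrite (_ : (b + b + 2 + b.+1 = (b + b + b).+3)%N) ?emono_n0 ?scaler0 ?addr0; last by lia.
rewrite addrACA -!big_split /= big_nat big1 // => j /andP[_ jb].
have -> : (2 * b + 2 + b - b + j = 2 * b + 2 + j)%N by lia.
have -> : (b + b + 2 + j = 2 * b + 2 + j)%N by lia.
have -> : (b.+2 - 1 - j = b.+1 - j)%N by lia.
rewrite !scalerA !(mulrAC _ _ ((-1) ^+ _)) -!exprD.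
rewrite (@eq_sign _ 1) ?(@eq_sign (j + (b.+1 - j)) b.+1); [|by lia..].
by rewrite expr1 exprS !mulN1r mulNr !scaleNr addrA addrK addNr.
Qed.

(** Identity (ii) for m = b+2 with the terms at 1 - 1/z on the right, where i stands for j-1 and the
    weight j/(m-1) is absorbed into the binomial. It is [sum_ediff] with a = b+1 and M = 2m. *)
Lemma mod_products_id2 b :
  \sum_(0 <= j < b.+2) ((-1) ^+ j * 'C(b + j, j)%:R) *:
    ((-1) ^+ (2 * b + 3 + j).+1 *: emono x y (2 * b + 3 + j) (b.+2 - j)
     + (-1) ^+ (b.+2 - j) *: emono x y (b.+2 - j) (2 * b + 3 + j))
  = \sum_(0 <= i < b.+1) ((-1) ^+ i * 'C(b.+1 + i, i)%:R) *:
      ediff x y (b.+1 - i) (2 * b + 4 + i).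
Proof.
rewrite sum_ediff; last by lia.
have -> : (2 * b + 4 - b.+1 = b.+3)%N by lia.
rewrite [X in _ = _ + X]big_nat_recr //=.
have -> : (b.+3 - 1 - b.+2 = 0)%N by lia.
rewrite (_ : (b.+1 + b + 2 + b.+2 = (b + b + b).+3.+2)%N) ?emono_n0 ?scaler0 ?addr0;
  last by lia.
rewrite -big_split /=; apply: eq_big_nat => j /andP[_ jb].
have -> : (2 * b + 4 + b - b.+1 + j = 2 * b + 3 + j)%N by lia.
have -> : (b.+1 + b + 2 + j = 2 * b + 3 + j)%N by lia.
have -> : (b.+3 - 1 - j = b.+2 - j)%N by lia.
rewrite scalerDr !scalerA !(mulrAC _ _ ((-1) ^+ _)) -!exprD.
rewrite (@eq_sign (j + (2 * b + 3 + j).+1) 0) ?(@eq_sign (j + (b.+2 - j)) b);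
  [|by lia..].
by rewrite mul1r addrC.
Qed.

(** Identity (iii) for m = b+2, with i = j-1 and the weight j/(m+j-2) absorbed. In [sum_ediff] with
    a = b and M = 2m-1, the terms at 1 - z cancel the low range and those at z the high range. *)
Lemma mod_products_id3 b :
  \sum_(0 <= j < b.+2) ((-1) ^+ j * 'C(b + j, j)%:R) *:
    ((-1) ^+ (2 * b + 2 + j).+1 *: emono x y (2 * b + 2 + j) (b.+2 - j))
  + \sum_(0 <= i < b.+1) ((-1) ^+ i * 'C(b + i, i)%:R) *:
      ((-1) ^+ (b.+1 - i) *: emono x y (b.+1 - i) (2 * b + 3 + i)
       + ediff x y (b.+1 - i) (2 * b + 3 + i)) = 0.
Proof.
have -> : \sum_(0 <= i < b.+1) ((-1) ^+ i * 'C(b + i, i)%:R) *: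
      ((-1) ^+ (b.+1 - i) *: emono x y (b.+1 - i) (2 * b + 3 + i)
       + ediff x y (b.+1 - i) (2 * b + 3 + i)) =
   \sum_(0 <= j < b.+2) 'C(b + j, j)%:R *:
       emono x y (2 * b + 2 + j) (b.+2 - j).
  under eq_big_nat => i _ do rewrite scalerDr.
  rewrite big_split /= sum_ediff; last by lia.
  have -> : (2 * b + 3 - b = b.+3)%N by lia.
  rewrite [X in _ + (_ + X)]big_nat_recr //=.
  have -> : (b.+3 - 1 - b.+2 = 0)%N by lia.
  rewrite (_ : (b + b + 2 + b.+2 = (b + b + b).+4)%N) ?emono_n0 ?scaler0 ?addr0;
    last by lia.
  rewrite addrA -big_split /= big_nat big1 ?add0r; last first.
    move=> i /andP[_ ib].
    have -> : (2 * b + 3 + b - b + i = 2 * b + 3 + i)%N by lia.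
    rewrite !scalerA !(mulrAC _ _ ((-1) ^+ _)) -!exprD.
    rewrite (@eq_sign (i + (b.+1 - i)) b.+1); last by lia.
    by rewrite -scalerDl exprS mulN1r mulNr addNr scale0r.
  apply: eq_big_nat => j _; congr (_ *: emono _ _ _ _); by lia.
rewrite -big_split /= big_nat big1 // => j /andP[_ jb].
rewrite !scalerA !(mulrAC _ _ ((-1) ^+ _)) -!exprD.
rewrite (@eq_sign _ 1); last by lia.
by rewrite -scalerDl expr1 mulN1r addNr scale0r.
Qed.

End ModProductIdentities.

(** * Derivatives of composites and of the substitutions 1 - z and 1 - 1/z *)

Section ChainRule.
Variable K : numFieldType.

Lemma is_derive1_chain (F phi : K^o -> K^o) (z D d : K^o) :
  is_derive (phi z) 1 F D -> is_derive z 1 phi d ->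
  is_derive z 1 (F \o phi) (D * d).
Proof.
move=> [dF <-] [dphi <-].
have F1 : differentiable F (phi z) by exact/derivable1_diffP.
have p1 : differentiable phi z by exact/derivable1_diffP.
have Fp : differentiable (F \o phi) z by exact: differentiable_comp.
apply: DeriveDef; first exact/derivable1_diffP.
have lin (c : K^o) : 'd F (phi z) c = c *: 'd F (phi z) 1.
  have {1}-> : c = c *: (1 : K^o) by rewrite /GRing.scale /= mulr1.
  exact: linearZ.
rewrite (deriveE _ Fp) (diff_comp p1 F1).
apply: etrans (lin _) _.
apply: etrans (congr2 *:%R (esym (deriveE _ p1)) (esym (deriveE _ F1))) _.
exact: mulrC.
Qed.

Lemma is_derive1_inv (z : K^o) : z != 0 ->
  is_derive z 1 (fun w : K^o => w^-1 : K^o) (- z ^- 2).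
Proof.
move=> z0; have did : derivable (id : K^o -> K^o) z 1 by exact: derivable_id.
apply: DeriveDef; first exact: (derivableV z0 did).
by rewrite (deriveV z0 did) derive_id /GRing.scale /= mulr1.
Qed.

Lemma is_derive1_onem (z : K^o) : is_derive z 1 (fun w : K^o => 1 - w : K^o) (- 1).
Proof.
apply: (is_derive_eq (is_deriveB (is_derive_cst _ _ _) (is_derive_id _ _))).
by rewrite sub0r.
Qed.

Lemma is_derive1_onem_inv (z : K^o) : z != 0 ->
  is_derive z 1 (fun w : K^o => 1 - w^-1 : K^o) (z ^- 2).
Proof.
move=> z0.
apply: (is_derive_eq (is_deriveB (is_derive_cst _ _ _) (is_derive1_inv z0))).
by rewrite sub0r opprK.
Qed.

Lemma is_derive1_lin (F G : K^o -> K^o) (z D d q : K^o) :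
  is_derive z 1 F D -> is_derive z 1 G d ->
  is_derive z 1 (fun w => q * F w + G w : K^o) (q * D + d).
Proof. by move=> dF dG; exact: (is_deriveD (is_deriveZ q dF) dG). Qed.

End ChainRule.

(** * The principal logarithm: derivative along paths and uniform expansions *)

Section ComplexPaths.
Variable R : realType.
Local Notation C := R[i].
Local Notation Re := complex.Re.
Local Notation Im := complex.Im.
Local Notation normc := ComplexField.Normc.normc.
Implicit Types (f g : R -> C) (t : R) (a u w z : C).

Lemma complex_eqP z w : Re z = Re w -> Im z = Im w -> z = w.
Proof. by case: z w => [a b] [c d] /= -> ->. Qed.

Lemma cReD z w : Re (z + w) = Re z + Re w. Proof. by case: z w => [a b] []. Qed.
Lemma cImD z w : Im (z + w) = Im z + Im w. Proof. by case: z w => [a b] []. Qed.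
Lemma cReB z w : Re (z - w) = Re z - Re w. Proof. by case: z w => [a b] []. Qed.
Lemma cImB z w : Im (z - w) = Im z - Im w. Proof. by case: z w => [a b] []. Qed.
Lemma cReM z w : Re (z * w) = Re z * Re w - Im z * Im w.
Proof. by case: z w => [a b] []. Qed.
Lemma cImM z w : Im (z * w) = Re z * Im w + Im z * Re w.
Proof. by case: z w => [a b] []. Qed.
Lemma cReMr z t : Re (t%:C * z) = t * Re z.
Proof. by rewrite cReM /= mul0r subr0. Qed.
Lemma cImMr z t : Im (t%:C * z) = t * Im z.
Proof. by rewrite cImM /= mul0r addr0. Qed.
Lemma cReV z : Re (z^-1) = Re z / (Re z ^+ 2 + Im z ^+ 2).
Proof. by case: z. Qed.
Lemma cImV z : Im (z^-1) = - Im z / (Re z ^+ 2 + Im z ^+ 2).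
Proof. by case: z => a b /=; rewrite mulNr. Qed.

(* [u] is the derivative at [t] of the path [f] in the complex plane. *)
Definition path_derive f t u :=
  is_derive t 1 (fun s => Re (f s)) (Re u) /\
  is_derive t 1 (fun s => Im (f s)) (Im u).

Lemma path_derive_eq f t u v : path_derive f t u -> u = v -> path_derive f t v.
Proof. by move=> + <-. Qed.

Lemma path_derive_cst t a : path_derive (fun=> a) t 0.
Proof. by split; exact: is_derive_cst. Qed.

Lemma path_derive_line t a u : path_derive (fun s => a + s%:C * u) t u.
Proof.
split.
  rewrite [X in is_derive _ _ X _](_ : _ = cst (Re a) + id * cst (Re u)); last first.
    by apply/funext => s; rewrite cReD cReMr.
  apply: (is_derive_eq (is_deriveD (is_derive_cst _ _ _)
    (is_deriveM (is_derive_id _ _) (is_derive_cst _ _ _)))).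
  by rewrite /GRing.scale /=; ring.
rewrite [X in is_derive _ _ X _](_ : _ = cst (Im a) + id * cst (Im u)); last first.
  by apply/funext => s; rewrite cImD cImMr.
apply: (is_derive_eq (is_deriveD (is_derive_cst _ _ _)
  (is_deriveM (is_derive_id _ _) (is_derive_cst _ _ _)))).
by rewrite /GRing.scale /=; ring.
Qed.

Lemma path_deriveM f g t u v : path_derive f t u -> path_derive g t v ->
  path_derive (fun s => f s * g s) t (f t * v + u * g t).
Proof.
move=> [fr fi] [gr gi]; split.
  rewrite [X in is_derive _ _ X _](_ : _ = (fun s => Re (f s)) * (fun s => Re (g s)) -
    (fun s => Im (f s)) * (fun s => Im (g s))); last first.
    by apply/funext => s; rewrite cReM.
  apply: (is_derive_eq (is_deriveB (is_deriveM fr gr) (is_deriveM fi gi))).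
  rewrite cReD !cReM /GRing.scale /=; ring.
rewrite [X in is_derive _ _ X _](_ : _ = (fun s => Re (f s)) * (fun s => Im (g s)) +
    (fun s => Im (f s)) * (fun s => Re (g s))); last first.
  by apply/funext => s; rewrite cImM.
apply: (is_derive_eq (is_deriveD (is_deriveM fr gi) (is_deriveM fi gr))).
rewrite cImD !cImM /GRing.scale /=; ring.
Qed.

Definition slit_plane : set C := [set w | ~~ (w <= 0)].

Lemma slit_planeP w : slit_plane w <-> (0 < Re w \/ Im w != 0).
Proof.
rewrite /slit_plane /= lecE /= eq_sym negb_and -ltNge; split.
  by move=> /orP[]; [right|left].
by move=> [->|->]; rewrite ?orbT.
Qed.

(** Positivity of the denominator in the half-angle formula: off the slit, either Re w > 0 or |Re w|
    < |w|. *)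
Lemma slit_plane_gt0 w : slit_plane w ->
  0 < Num.sqrt (Re w ^+ 2 + Im w ^+ 2) + Re w.
Proof.
move=> /slit_planeP[w0|w0].
  by rewrite ltr_wpDl ?sqrtr_ge0.
rewrite -ltrBlDr sub0r; apply: le_lt_trans (ler_norm _) _.
rewrite normrN -sqrtr_sqr ltr_sqrt; last first.
  by rewrite ltr_wpDl ?sqr_ge0 // exprn_even_gt0.
by rewrite ltrDl exprn_even_gt0.
Qed.

(** The derivative of the argument 2 atan (y/(r+x)), where [b] and [c] are the derivatives of [x]
    and [y], and (xb + yc)/r is that of the modulus [r]. The half-angle identity 1 + (y/(r+x))^2 =
    2r/(r+x) collapses it to the classical (xy' - yx')/r^2. *)
Lemma arg_derive_eq (x y r b c : R) :
  r != 0 -> r + x != 0 -> y ^+ 2 = r ^+ 2 - x ^+ 2 ->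
  2 * ((1 + (y / (r + x)) ^+ 2)^-1 *
    ((c * (r + x) - y * ((x * b + y * c) / r + b)) / (r + x) ^+ 2)) =
  (c * x - b * y) / r ^+ 2.
Proof.
move=> nr nrx y2.
have -> : (1 + (y / (r + x)) ^+ 2)^-1 = (r + x) / (2 * r).
  have N : (r + x) ^+ 2 + (r ^+ 2 - x ^+ 2) = 2 * r * (r + x) by ring.
  rewrite expr_div_n y2; field.
  by rewrite nr nrx N !mulf_neq0 // pnatr_eq0.
have -> : c * (r + x) - y * ((x * b + y * c) / r + b) =
    (c * x - b * y) * (r + x) / r.
  have -> : y * ((x * b + y * c) / r + b) =
    (x * y * b + y ^+ 2 * c) / r + y * b by field.
  by rewrite y2; field.
by field; rewrite nr nrx.
Qed.

Lemma path_derive_Clog f t u : slit_plane (f t) -> path_derive f t u ->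
  path_derive (fun s => Clog (f s)) t (u / f t).
Proof.
move=> slf [fr fi].
have rx0 := slit_plane_gt0 slf.
set x := Re (f t); set y := Im (f t).
have q0 : 0 < x ^+ 2 + y ^+ 2.
  move/slit_planeP : slf => -[h|h]; rewrite -/x -/y in h.
    by rewrite ltr_wpDr ?sqr_ge0 // exprn_gt0.
  by rewrite ltr_wpDl ?sqr_ge0 // exprn_even_gt0.
pose q := (fun s => Re (f s)) ^+ 2 + (fun s => Im (f s)) ^+ 2.
have dq : is_derive t 1 q (2 * (x * Re u + y * Im u)).
  apply: (is_derive_eq (is_deriveD (is_deriveX 2 fr) (is_deriveX 2 fi))).
  by rewrite /GRing.scale /= -/x -/y; ring.
have dr : is_derive t 1 (Num.sqrt \o q)
    ((2 * Num.sqrt (q t))^-1 * (2 * (x * Re u + y * Im u))).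
  by apply: is_derive1_comp; apply: is_derive1_sqrt.
set r := Num.sqrt (x ^+ 2 + y ^+ 2).
have r0 : 0 < r by rewrite sqrtr_gt0.
have nq : x ^+ 2 + y ^+ 2 != 0 by rewrite gt_eqF.
have nr : r != 0 by rewrite gt_eqF.
have nrx : r + x != 0 by rewrite gt_eqF.
have r2 : r ^+ 2 = x ^+ 2 + y ^+ 2 by rewrite sqr_sqrtr // ltW.
have {}dr : is_derive t 1 (Num.sqrt \o q) ((x * Re u + y * Im u) / r).
  apply: is_derive_eq; rewrite /= -[q t]/(x ^+ 2 + y ^+ 2) -/r.
  by field; rewrite ?nr ?nrx ?nq.
have rE : (Num.sqrt \o q) t = r by [].
have x0 : 0 < r + x by [].
have dE : u / f t = ((Re u * x + Im u * y) / r ^+ 2) +i*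
     ((Im u * x - Re u * y) / r ^+ 2).
  by apply: complex_eqP; rewrite /= ?cReM ?cImM cReV cImV -/x -/y r2; field; rewrite ?nr ?nrx ?nq.
rewrite dE; split => /=.
  have dl : is_derive (Num.sqrt (q t)) 1 (@ln R) r^-1.
    by rewrite -[Num.sqrt (q t)]rE rE; exact: is_derive1_ln.
  have dc := @is_derive1_comp R (@ln R) (Num.sqrt \o q) t _ _ dl dr.
  by apply: (is_derive_eq dc); field; rewrite ?nr ?nrx ?nq.
pose g := (fun s => Im (f s)) * (fun s => (((Num.sqrt \o q) + (fun s => Re (f s))) s)^-1).
have dg : is_derive t 1 g ((Im u * (r + x) -
    y * ((x * Re u + y * Im u) / r + Re u)) / (r + x) ^+ 2).
  have n0 : ((Num.sqrt \o q) + (fun s => Re (f s))) t != 0 by rewrite gt_eqF.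
  apply: (is_derive_eq (is_deriveM fi (is_deriveV n0 (is_deriveD dr fr)))).
  rewrite /GRing.scale /= -/x -/y.
  rewrite -[((Num.sqrt \o q) + (fun s => Re (f s))) t]/(r + x).
  by field; rewrite ?nr ?nrx ?nq.
have gE : g t = y / (r + x) by [].
have da := @is_derive1_comp R (@atan R) g t _ _ (is_derive1_atan (g t)) dg.
rewrite [X in is_derive _ _ X _](_ : _ = cst 2 * (atan \o g)); last first.
  by apply/funext.
apply: (is_derive_eq (is_deriveM (is_derive_cst _ _ _) da)).
rewrite /GRing.scale /= gE mulr0 addr0.
by apply: arg_derive_eq; rewrite // r2; ring.
Qed.

Lemma normc_ge_Re z : `|Re z| <= normc z.
Proof. by case: z => a b /=; rewrite -sqrtr_sqr ler_wsqrtr // lerDl sqr_ge0. Qed.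

Lemma normc_ge_Im z : `|Im z| <= normc z.
Proof. by case: z => a b /=; rewrite -sqrtr_sqr ler_wsqrtr // lerDr sqr_ge0. Qed.

Lemma normc_ge0 z : 0 <= normc z.
Proof. exact: le_trans (normr_ge0 _) (normc_ge_Re z). Qed.

Lemma normc_le_ReIm z : normc z <= `|Re z| + `|Im z|.
Proof.
case: z => a b /=; rewrite -[leRHS]ger0_norm ?addr_ge0 // -sqrtr_sqr.
rewrite ler_wsqrtr // sqrrD !real_normK ?num_real // addrAC.
by rewrite lerDl mulrn_wge0 // mulr_ge0.
Qed.

Lemma normc_real t : normc t%:C = `|t|.
Proof. by rewrite /= expr0n addr0 sqrtr_sqr. Qed.

Lemma normcX z n : normc (z ^+ n) = normc z ^+ n.
Proof.
elim: n => [|n IH]; first by rewrite !expr0 ComplexField.Normc.normc1.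
by rewrite !exprS ComplexField.Normc.normcM IH.
Qed.

Lemma normcE z : `|z| = (normc z)%:C.
Proof. by []. Qed.

Lemma normc_nat n : normc (n%:R : C) = n%:R.
Proof.
have -> : n%:R = (n%:R : R)%:C :> C by rewrite rmorph_nat.
by rewrite normc_real ger0_norm.
Qed.

(** The mean value theorem is applied to the real and imaginary parts separately, whence the factor
    2. *)
Lemma path_MVT f d (M : R) : (forall s, 0 <= s <= 1 -> path_derive f s (d s)) ->
  (forall s, 0 <= s <= 1 -> normc (d s) <= M) -> normc (f 1 - f 0) <= 2 * M.
Proof.
move=> df dM; apply: le_trans (normc_le_ReIm _) _; rewrite mulr_natl mulr2n.
have in01 (x : R) : x \in `]0, 1[ -> 0 <= x <= 1.
  by rewrite in_itv /= => /andP[/ltW -> /ltW ->].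
have in01c (x : R) : x \in `[0, 1] -> 0 <= x <= 1.
  by rewrite in_itv /=.
rewrite cReB cImB lerD //.
  have [||c c01 ->] := @MVT_segment R (fun s => Re (f s)) (fun s => Re (d s)) 0 1 ler01.
  - by move=> x /in01/df[].
  - apply: derivable_within_continuous => x /in01c/df[[]]; done.
  - rewrite subr0 mulr1; exact: le_trans (normc_ge_Re _) (dM _ (in01c _ c01)).
have [||c c01 ->] := @MVT_segment R (fun s => Im (f s)) (fun s => Im (d s)) 0 1 ler01.
- by move=> x /in01/df[].
- apply: derivable_within_continuous => x /in01c/df[_ []]; done.
- rewrite subr0 mulr1; exact: le_trans (normc_ge_Im _) (dM _ (in01c _ c01)).
Qed.

Lemma normc_gt0_neq0 z (d : R) : 0 < d -> d <= normc z -> z != 0.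
Proof.
move=> d0 dz; apply: contraTneq (lt_le_trans d0 dz) => ->.
by rewrite ComplexField.Normc.normc0 ltxx.
Qed.

Lemma normcV_le z (d : R) : 0 < d -> d <= normc z -> normc z^-1 <= d^-1.
Proof.
move=> d0 dz; rewrite ComplexField.Normc.normcV lef_pV2 //.
by rewrite posrE (lt_le_trans d0 dz).
Qed.

Section Segment.
Variables (a u : C) (d : R).
Hypotheses (d0 : 0 < d)
  (sl : forall s : R, 0 <= s <= 1 -> slit_plane (a + s%:C * u))
  (sd : forall s : R, 0 <= s <= 1 -> d <= normc (a + s%:C * u)).

Lemma Clog_lipschitz : normc (Clog (a + u) - Clog a) <= 2 * (normc u / d).
Proof.
have -> : a + u = a + (1:R)%:C * u by rewrite mul1r.
have {2}-> : a = a + (0:R)%:C * u by rewrite mul0r addr0.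
apply: (@path_MVT (fun s => Clog (a + s%:C * u)) (fun s => u / (a + s%:C * u))).
  by move=> s s01; apply/path_derive_Clog/path_derive_line/sl.
move=> s s01; rewrite ComplexField.Normc.normcM ler_wpM2l ?normc_ge0 //.
by apply: normcV_le => //; exact: sd.
Qed.

(** The mean value bound is applied to the path Clog (a + su) - su/a, whose derivative is -s u^2 /
    (a (a + su)). *)
Lemma Clog_quadratic :
  normc (Clog (a + u) - Clog a - u / a) <= 2 * (normc u ^+ 2 / d ^+ 2).
Proof.
have a0 : d <= normc a by have := sd (s := 0); rewrite mul0r addr0; apply; rewrite lexx ler01.
pose g (s : R) := Clog (a + s%:C * u) + (0 + s%:C * (- (u / a))).
have -> : Clog (a + u) - Clog a - u / a = g 1 - g 0.
  by rewrite /g !mul1r !mul0r !add0r !addr0; ring.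
apply: (@path_MVT g (fun s => u / (a + s%:C * u) - u / a)).
  move=> s s01; have [h1 h2] := path_derive_Clog (sl s01) (path_derive_line s a u).
  have [k1 k2] := path_derive_line s 0 (- (u / a)).
  split.
    rewrite [X in is_derive _ _ X _](_ : _ = (fun s => Re (Clog (a + s%:C * u))) +
        (fun s => Re (0 + s%:C * (- (u / a))))); last by apply/funext => x; rewrite cReD.
    by rewrite cReD; exact: is_deriveD.
  rewrite [X in is_derive _ _ X _](_ : _ = (fun s => Im (Clog (a + s%:C * u))) +
      (fun s => Im (0 + s%:C * (- (u / a))))); last by apply/funext => x; rewrite cImD.
  by rewrite cImD; exact: is_deriveD.
move=> s s01; have sds := sd s01.
have -> : u / (a + s%:C * u) - u / a = - s%:C * u ^+ 2 * (a^-1 * (a + s%:C * u)^-1).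
  by field; rewrite (normc_gt0_neq0 d0 a0) (normc_gt0_neq0 d0 sds).
rewrite ComplexField.Normc.normcM [normc (_ * u ^+ 2)]ComplexField.Normc.normcM.
rewrite [normc (a^-1 * _)]ComplexField.Normc.normcM normcX normcN normc_real.
apply: ler_pM; rewrite ?mulr_ge0 ?normc_ge0 ?exprn_ge0 ?normc_ge0 //.
  case/andP: s01 => s0 s1; rewrite ger0_norm // ler_piMl ?exprn_ge0 ?normc_ge0 //.
by rewrite expr2 invfM ler_pM ?normc_ge0 ?normcV_le.
Qed.

End Segment.

(** Replaces complex differentiability by an inequality, a form that survives integration in t. *)
Lemma quadratic_is_derive (F : C -> C) z D (d M : R) : 0 < d ->
  (forall h, normc h < d -> normc (F (z + h) - F z - h * D) <= M * normc h ^+ 2) ->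
  is_derive (z : C^o) 1 (F : C^o -> C^o) D.
Proof.
move=> d0 H.
suff cv : (fun h : C^o => h^-1 *:
    ((F : C^o -> C^o) (h *: 1 + z) - (F : C^o -> C^o) z)) @ 0^' --> (D : C^o).
  by apply: DeriveDef; [apply/cvg_ex; exists D | exact: cvg_lim].
apply/cvgrPdist_le => /= e e0.
have eR : e = (Re e)%:C by rewrite RRe_real // gtr0_real.
have re0 : 0 < Re e by move: e0; rewrite {1}eR ltcR.
(* The sign of [M] is free, so a positive majorant is needed before dividing by it. *)
pose M' := `|M| + 1.
have M0 : 0 < M' by rewrite ltr_pwDr.
near=> h.
have h0 : h != 0 by near: h; exact: nbhs_dnbhs_neq.
have hd : normc h < Num.min d (Re e / M').
  rewrite -ltcR -normcE.
  near: h; apply: dnbhs0_lt; rewrite ltcR lt_min d0 divr_gt0 //.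
move: hd; rewrite lt_min => /andP[hd hM].
have := H h hd.
have -> : F (z + h) - F z - h * D =
    - h * (D - h^-1 *: ((F : C^o -> C^o) (h *: 1 + z) - (F : C^o -> C^o) z)).
  by rewrite /GRing.scale /= mulr1 [h + z]addrC; field.
rewrite ComplexField.Normc.normcM normcN expr2 mulrCA ler_pM2l; last first.
  rewrite lt_neqAle normc_ge0 andbT eq_sym; apply: contra h0 => /eqP h0.
  by rewrite (ComplexField.Normc.eq0_normc h0).
rewrite eR normcE lecR => /le_trans; apply.
apply: (@le_trans _ _ (M' * normc h)).
  rewrite ler_wpM2r ?normc_ge0 // /M' (le_trans (ler_norm _)) // lerDl ler01 //.
by rewrite mulrC -ler_pdivlMr // ltW.
Unshelve. all: by end_near. Qed.

Definition cut1 : set C := [set z | ~~ (1 <= z)].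

Lemma cut1P z : cut1 z <-> (Re z < 1 \/ Im z != 0).
Proof.
rewrite /cut1 /= lecE /= negb_and -ltNge; split.
  by move=> /orP[]; [right|left].
by move=> [->|->]; rewrite ?orbT.
Qed.

(** If 1 - zt were a nonpositive real, zt would be a real at least 1, and then so would z, because t
    <= 1. *)
Lemma cut1_slit z t : cut1 z -> 0 <= t <= 1 -> slit_plane (1 - z * t%:C).
Proof.
move=> /cut1P cz /andP[t0 t1]; apply/slit_planeP.
rewrite mulrC cReB cImB cReMr cImMr /= sub0r oppr_eq0.
case: (eqVneq t 0) => [->|tn0]; first by left; rewrite mul0r subr0.
case: cz => [cz|cz]; [left|right; last by rewrite mulf_neq0].
have tp : 0 < t by rewrite lt_def tn0.
rewrite subr_gt0; apply: lt_le_trans t1.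
by rewrite -[ltRHS]mulr1 ltr_pM2l.
Qed.

(** If Re z < 1, the real part of 1 - zt is at least min(1, 1 - Re z). If Im z is nonzero, the
    triangle inequality gives 1/2 as long as |zt| <= 1/2, and beyond that the imaginary part, of
    size t |Im z|, is at least |Im z|/(2|z|). *)
Lemma cut1_dist z : cut1 z -> exists2 d : R, 0 < d &
  forall t, 0 <= t <= 1 -> d <= normc (1 - z * t%:C).
Proof.
move=> /cut1P[z1|z1].
  exists (Num.min 1 (1 - Re z)); first by rewrite lt_min ltr01 subr_gt0.
  move=> t /andP[t0 t1]; apply: le_trans (normc_ge_Re _).
  rewrite mulrC cReB cReMr /=; apply: le_trans (ler_norm _).
  case: (leP (Re z) 0) => z0.
    by rewrite ge_min lerBrDr gerDl mulr_ge0_le0.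
  rewrite ge_min; apply/orP; right; rewrite lerD2l lerN2.
  by rewrite ler_piMl // ltW.
have nz : 0 < normc z.
  by apply: lt_le_trans (normc_ge_Im z); rewrite normr_gt0.
exists (Num.min 2^-1 (`|Im z| / (2 * normc z))).
  by rewrite lt_min invr_gt0 ltr0n divr_gt0 ?normr_gt0 // mulr_gt0.
move=> t /andP[t0 t1].
case: (leP (normc z * t) 2^-1) => zt.
  rewrite ge_min; apply/orP; left.
  have := le_normcD (1 - z * t%:C) (z * t%:C).
  rewrite subrK ComplexField.Normc.normc1 ComplexField.Normc.normcM normc_real.
  rewrite (ger0_norm t0); lra.
rewrite ge_min; apply/orP; right; apply: le_trans (normc_ge_Im _).
rewrite [z * _]mulrC cImB cImMr /= sub0r normrN normrM (ger0_norm t0).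
rewrite [leLHS]mulrC ler_wpM2r // invfM.
by rewrite ler_pdivrMr // mulrC ltW.
Qed.

Lemma cut1_nbhs z : cut1 z -> exists2 d : R, 0 < d &
  forall h, normc h < d -> cut1 (z + h).
Proof.
move=> /cut1P[z1|z1].
  exists (1 - Re z); first by rewrite subr_gt0.
  move=> h hd; apply/cut1P; left; rewrite cReD addrC -ltrBrDr.
  exact: le_lt_trans (le_trans (ler_norm _) (normc_ge_Re h)) hd.
exists (`|Im z|); first by rewrite normr_gt0.
move=> h hd; apply/cut1P; right; rewrite cImD; apply/eqP => E.
have {}E : Im z = - Im h by lra.
by move: hd; rewrite E normrN ltNge normc_ge_Im.
Qed.

Lemma cut1_unif z : cut1 z -> exists d : R, [/\ 0 < d, d <= 1 &
  forall h t, normc h <= d -> 0 <= t <= 1 ->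
   slit_plane (1 - (z + h) * t%:C) /\ d <= normc (1 - (z + h) * t%:C)].
Proof.
move=> cz; have [d1 d10 H1] := cut1_dist cz; have [d2 d20 H2] := cut1_nbhs cz.
(* Halving [d1] leaves room for |ht| in the lower bound, halving [d2] makes |h| < d2 strict, and 1
   keeps |z + h| below |z| + 1 later on. *)
exists (Num.min 1 (Num.min (d1 / 2) (d2 / 2))).
split; [by rewrite !lt_min ltr01 !divr_gt0 | by rewrite ge_min lexx|].
move=> h t; rewrite !le_min => /and3P[h1 hd1 hd2] t01; split.
  by apply: cut1_slit t01; apply: H2; lra.
apply: (@le_trans _ _ (d1 / 2)).
  by rewrite !ge_min lexx orbT.
have := le_normcD (1 - (z + h) * t%:C) (h * t%:C).
have -> : 1 - (z + h) * t%:C + h * t%:C = 1 - z * t%:C by ring.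
rewrite ComplexField.Normc.normcM normc_real; case/andP: (t01) => t0 t1.
have := H1 t t01; rewrite ger0_norm //.
have : normc h * t <= normc h by rewrite ler_piMr // normc_ge0.
lra.
Qed.

Lemma Clog1 : Clog (1 : C) = 0.
Proof.
by rewrite /Clog /= expr1n expr0n addr0 sqrtr1 ln1 mul0r atan0 mulr0.
Qed.

(* Expansion of the integrand's logarithm at [z], uniform in [t]; the factors
   [t] compensate the division by [t] in the integrals. *)
Lemma Clog_unif z : cut1 z -> exists d K : R, [/\ 0 < d, 1 <= K &
  forall h t, normc h <= d -> 0 <= t <= 1 ->
  [/\ normc (Clog (1 - (z + h) * t%:C)) <= K * t,
      normc (t%:C / (1 - z * t%:C)) <= K * t &
      normc (Clog (1 - (z + h) * t%:C) - Clog (1 - z * t%:C)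
             - h * - (t%:C / (1 - z * t%:C)))
        <= K * (normc h ^+ 2 * t) ]].
Proof.
move=> cz; have [d [d0 d1 H]] := cut1_unif cz.
(* One summand per requirement: [1 <= K], the Lipschitz bound from 1 to 1 - (z+h)t, the bound on
   1/(1 - zt), and the quadratic remainder. *)
pose K := 1 + 2 * ((normc z + 1) / d) + d^-1 + 2 / d ^+ 2.
have z0 := normc_ge0 z.
have K1 : 0 <= 2 * ((normc z + 1) / d) by rewrite mulr_ge0 ?divr_ge0 // ?ltW //; lra.
have K2 : 0 <= d^-1 by rewrite invr_ge0 ltW.
have K3 : 0 <= 2 / d ^+ 2 by rewrite divr_ge0 // exprn_ge0 // ltW.
exists d, K; split; [by []|by rewrite /K; lra|].
move=> h t hd /andP[t0 t1].
have nt : normc t%:C = t by rewrite normc_real ger0_norm.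
have sub (s : R) : 0 <= s <= 1 -> 0 <= s * t <= 1.
  by move=> /andP[s0 s1]; rewrite mulr_ge0 //= mulr_ile1.
split.
- have := @Clog_lipschitz 1 (- ((z + h) * t%:C)) d d0.
  rewrite Clog1 subr0 normcN ComplexField.Normc.normcM nt.
  (* The segment issued from 1 stays in the family: its parameter only rescales t to st. *)
  have E (s : R) : 1 + s%:C * (- ((z + h) * t%:C)) = 1 - (z + h) * (s * t)%:C.
    by rewrite rmorphM /=; ring.
  move=> /(_ _ _)/le_trans; apply.
  + by move=> s /sub /(H _ _ hd)[+ _]; rewrite E.
  + by move=> s /sub /(H _ _ hd)[_]; rewrite E.
  have -> : 2 * (normc (z + h) * t / d) = 2 * (normc (z + h) / d) * t by ring.
  rewrite ler_wpM2r // (@le_trans _ _ (2 * ((normc z + 1) / d))) //; last first.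
    by rewrite /K; lra.
  rewrite ler_wpM2l // ler_wpM2r //.
  by apply: le_trans (le_normcD _ _) _; rewrite lerD2l (le_trans hd).
- rewrite ComplexField.Normc.normcM nt mulrC ler_wpM2r //.
  have Hd : d <= normc (1 - z * t%:C).
    have := H 0 t; rewrite addr0 ComplexField.Normc.normc0 => -[|| _ //].
      exact: ltW.
    by rewrite t0.
  by apply: le_trans (normcV_le d0 Hd) _; rewrite /K; lra.
- have := @Clog_quadratic (1 - z * t%:C) (- (h * t%:C)) d d0.
  have E (s : R) : 1 - z * t%:C + s%:C * (- (h * t%:C)) = 1 - (z + s%:C * h) * t%:C.
    by ring.
  have E1 : 1 - z * t%:C - h * t%:C = 1 - (z + h) * t%:C by ring.
  have hs (s : R) : 0 <= s <= 1 -> normc (s%:C * h) <= d.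
    move=> /andP[s0 s1]; apply: le_trans hd.
    by rewrite ComplexField.Normc.normcM normc_real ger0_norm // ler_piMl ?normc_ge0.
  rewrite E1 normcN ComplexField.Normc.normcM nt.
  have -> : - (h * t%:C) / (1 - z * t%:C) = h * - (t%:C / (1 - z * t%:C)) by ring.
  move=> /(_ _ _)/le_trans; apply.
  + by move=> s s01; rewrite E; apply: (H _ _ (hs s s01) _).1; rewrite t0 t1.
  + by move=> s s01; rewrite E; apply: (H _ _ (hs s s01) _).2; rewrite t0 t1.
  have -> : 2 * ((normc h * t) ^+ 2 / d ^+ 2) = 2 / d ^+ 2 * t * (normc h ^+ 2 * t).
    by ring.
  rewrite ler_wpM2r // ?mulr_ge0 ?exprn_ge0 ?normc_ge0 //.
  by apply: (@le_trans _ _ (2 / d ^+ 2)); [rewrite ler_piMr | rewrite /K; lra].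
Qed.

(** The remainder estimate passes to powers while keeping one factor t, to be consumed by the 1/t of
    the integrand. [B] is chosen before t and h, so the bound is uniform. *)
Lemma expr_quadratic (K : R) p : 1 <= K -> exists2 B : R, 0 <= B &
  forall (A A0 A1 h : C) t, 0 <= t <= 1 -> normc h <= 1 ->
    normc A <= K * t -> normc A0 <= K * t -> normc A1 <= K * t ->
    normc (A - A0 - h * A1) <= K * (normc h ^+ 2 * t) ->
    normc (A ^+ p.+1 - A0 ^+ p.+1 - h * (p.+1%:R * A0 ^+ p * A1))
      <= B * (normc h ^+ 2 * t).
Proof.
move=> K1; have K0 : 0 <= K by lra.
elim: p => [|p [B B0 IH]].
  exists K => //.
  by move=> A A0 A1 h t t01 h1 _ _ _; rewrite !expr1 expr0 !mul1r.
exists (K * B + K * (p.+2%:R * K ^+ p.+1) + p.+1%:R * K ^+ p.+2).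
  have X (n k : nat) : 0 <= n%:R * K ^+ k by rewrite mulr_ge0 ?exprn_ge0 ?ler0n.
  apply: addr_ge0 (X _ _); apply: addr_ge0; apply: mulr_ge0 => //; exact: X.
move=> A A0 A1 h t t01 h1 AK A0K A1K HA.
have := IH _ _ _ _ _ t01 h1 AK A0K A1K HA.
have le1 w : normc w <= K * t -> normc w <= K.
  by move=> /le_trans; apply; rewrite ler_piMr //; case/andP: t01.
have A1t := A1K; move: AK A0K A1K => /le1 AK /le1 A0K /le1 A1K.
set E := _ - h * (p.+1%:R * A0 ^+ p * A1) => HE.
pose Q := A0 ^+ p.+1 + h * (p.+1%:R * A0 ^+ p * A1).
(* Here A^(p+1) = Q + E, and A Q is compared with (A0 + h A1) Q, whose part quadratic in h is the
   last summand. *)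
have -> : A ^+ p.+2 - A0 ^+ p.+2 - h * (p.+2%:R * A0 ^+ p.+1 * A1) =
  A * E + (A - A0 - h * A1) * Q + h ^+ 2 * (p.+1%:R * A0 ^+ p * A1 ^+ 2).
  by rewrite /E /Q !exprS -![p.+2%:R]natr1; ring.
have X0 (n : nat) : normc (A0 ^+ n) <= K ^+ n.
  by rewrite normcX lerXn2r ?nnegrE ?normc_ge0.
have t0 : 0 <= t by case/andP: t01.
have h2t : 0 <= normc h ^+ 2 * t by rewrite mulr_ge0 ?exprn_ge0 ?normc_ge0.
have nM z w : normc (z * w) = normc z * normc w by exact: ComplexField.Normc.normcM.
have QK : normc Q <= p.+2%:R * K ^+ p.+1.
  apply: le_trans (le_normcD _ _) _; rewrite -[p.+2%:R]natr1 addrC mulrDl mul1r lerD ?X0 //.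
  rewrite nM -[leRHS]mul1r ler_pM ?normc_ge0 // !nM normc_nat exprSr mulrA.
  by rewrite !ler_pM ?mulr_ge0 ?normc_ge0 ?X0.
set w := normc h ^+ 2 * t in h2t HE HA *.
have T1 : normc (A * E) <= K * B * w by rewrite nM -mulrA ler_pM ?normc_ge0.
have T2 : normc ((A - A0 - h * A1) * Q) <= K * (p.+2%:R * K ^+ p.+1) * w.
  by rewrite nM mulrAC ler_pM ?normc_ge0.
have T3 : normc (h ^+ 2 * (p.+1%:R * A0 ^+ p * A1 ^+ 2)) <= p.+1%:R * K ^+ p.+2 * w.
  rewrite nM [normc (_ * A1 ^+ 2)]nM [normc (_ * A0 ^+ p)]nM normc_nat.
  rewrite [normc (h ^+ 2)]normcX [normc (A1 ^+ 2)]normcX /w.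
  have -> : p.+1%:R * K ^+ p.+2 * (normc h ^+ 2 * t) =
     normc h ^+ 2 * (p.+1%:R * K ^+ p * (K * t * K)) by rewrite !exprS; ring.
  rewrite ler_wpM2l ?exprn_ge0 ?normc_ge0 // ler_pM ?mulr_ge0 ?exprn_ge0 ?normc_ge0 //.
    by rewrite ler_wpM2l ?X0.
  by rewrite expr2 ler_pM ?normc_ge0.
rewrite [leRHS]mulrDl [X in _ <= X + _]mulrDl.
apply: le_trans (le_normcD _ _) _; apply: lerD T3.
by apply: le_trans (le_normcD _ _) _; exact: lerD.
Qed.

End ComplexPaths.

(** * Integrability of powers of the logarithm and an improper fundamental theorem *)

Section RealIntegrals.
Variable R : realType.
Notation mu := (@lebesgue_measure R).
Implicit Types (F f g : R -> R) (a b t : R).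

Lemma integral_is_derive F f a b : a < b ->
  (forall t, a <= t <= b -> is_derive t 1 F (f t)) ->
  (forall t, a <= t <= b -> derivable f t 1) ->
  (\int[mu]_(t in `[a, b]) (f t)%:E = (F b)%:E - (F a)%:E)%E.
Proof.
move=> ab dF df.
have cw g : (forall t, a <= t <= b -> derivable g t 1) ->
    {within `[a, b], continuous g}.
  by move=> dg; apply: derivable_within_continuous => x; rewrite in_itv /=; exact: dg.
have dF' t : a <= t <= b -> derivable F t 1 by move=> /dF[].
have oo t : t \in `]a, b[ -> a <= t <= b.
  by rewrite in_itv /= => /andP[/ltW -> /ltW ->].
apply: continuous_FTC2 => //.
- exact: cw.
- have /(continuous_within_itvP _ ab)[_ Fa Fb] := cw F dF'.
  by split => // t /oo /dF'.
- by move=> t /oo /dF [_]; rewrite derive1E.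
Qed.

Lemma derivable_measurable f : (forall t, 0 < t <= 1 -> derivable f t 1) ->
  measurable_fun `](0:R), 1] f.
Proof.
move=> df; apply: subspace_continuous_measurable_fun => //.
by apply: derivable_within_continuous => t; rewrite in_itv /=; exact: df.
Qed.

Lemma bigcup_itv_inv :
  \bigcup_n `[(n.+1%:R)^-1, 1]%classic = `]0, 1]%classic :> set R.
Proof.
apply/seteqP; split => [t [n _] /=|t /=]; rewrite !in_itv /=.
  by move=> /andP[nt ->]; rewrite (lt_le_trans _ nt) // invr_gt0.
move=> /andP[t0 t1]; exists (Num.truncn t^-1) => //=; rewrite in_itv /= t1 andbT.
rewrite -[leRHS]invrK lef_pV2 ?posrE ?invr_gt0 //.
by apply/ltW; have /truncn_itv/andP[] : 0 <= t^-1 by rewrite invr_ge0 ltW.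
Qed.

Lemma is_derive_sqrt2 t : 0 < t ->
  is_derive t 1 (fun s => 2 * Num.sqrt s) (Num.sqrt t)^-1.
Proof.
move=> t0; apply: (is_derive_eq (is_deriveZ 2 (is_derive1_sqrt t0))).
by rewrite /GRing.scale /= invfM mulrA divff ?mul1r.
Qed.

Lemma derivable_invsqrt t : 0 < t -> derivable (fun s : R => (Num.sqrt s)^-1) t 1.
Proof.
move=> t0; have n0 : Num.sqrt t != 0 by rewrite gt_eqF ?sqrtr_gt0.
by have [] := is_deriveV n0 (is_derive1_sqrt t0).
Qed.

(** Monotone convergence along [1/(n+1), 1], where the antiderivative 2 sqrt t keeps the integrals
    below 2. *)
Lemma integrable_invsqrt :
  mu.-integrable `]0, 1] (EFin \o (fun t => (Num.sqrt t)^-1)).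
Proof.
have mf : measurable_fun `](0:R), 1] (fun t : R => (Num.sqrt t)^-1).
  by apply: derivable_measurable => t /andP[t0 _]; exact: derivable_invsqrt.
apply/integrableP; split; first exact/measurable_EFinP.
rewrite -bigcup_itv_inv.
have f0 (t : R) : 0 <= (Num.sqrt t)^-1 by rewrite invr_ge0 sqrtr_ge0.
under eq_integral => t _ do rewrite /= ger0_norm //.
have nd : nondecreasing_seq (fun n => `[(n.+1%:R)^-1, 1]%classic : set R).
  apply/nondecreasing_seqP => n; rewrite subsetEset => t /=; rewrite !in_itv /=.
  move=> /andP[+ ->]; rewrite andbT; apply: le_trans.
  by rewrite lef_pV2 ?posrE // ler_nat.
have cv := @ge0_nondecreasing_set_cvg_integral _ (measurableTypeR R) R
  (fun n => `[((n.+1%:R)^-1 : R), 1]%classic) (fun t : R => ((Num.sqrt t)^-1)%:E) mu nd.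
apply: (@le_lt_trans _ _ 2%:E); last exact: ltry.
have mF n : measurable_fun `[(n.+1%:R^-1 : R), 1] (fun t : R => ((Num.sqrt t)^-1)%:E).
  apply/measurable_EFinP; apply: measurable_funS mf => //.
  by rewrite -bigcup_itv_inv; exact: (@bigcup_sup _ _ n).
have f0E (t : R) : (0 <= ((Num.sqrt t)^-1)%:E)%E by rewrite lee_fin.
have {}cv := cv (fun=> measurable_itv _) mF (fun _ t _ => f0E t).
rewrite -(cvg_lim _ cv) //; apply: lime_le; first by apply/cvg_ex; eexists; exact: cv.
near=> n.
have n0 : (0 : R) < n.+1%:R^-1 by rewrite invr_gt0.
have n1 : n.+1%:R^-1 < 1 :> R.
  by rewrite invf_lt1 // ltr1n ltnS; near: n; exact: nbhs_infty_gt.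
have H1 t : n.+1%:R^-1 <= t <= 1 ->
    is_derive t 1 (fun s => 2 * Num.sqrt s) (Num.sqrt t)^-1.
  by move=> /andP[nt _]; apply: is_derive_sqrt2; exact: lt_le_trans nt.
have H2 t : n.+1%:R^-1 <= t <= 1 -> derivable (fun s : R => (Num.sqrt s)^-1) t 1.
  by move=> /andP[nt _]; apply: derivable_invsqrt; exact: lt_le_trans nt.
have -> := integral_is_derive n1 H1 H2.
by rewrite sqrtr1 mulr1 -EFinB lee_fin gerBl mulr_ge0 ?sqrtr_ge0.
Unshelve. all: by end_near. Qed.

(** This is x^k / k! <= e^x at x = -ln t / 2, where e^x = t^(-1/2). *)
Lemma ln_pow_le k t : 0 < t <= 1 ->
  (- ln t) ^+ k <= 2 ^+ k * k`!%:R / Num.sqrt t.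
Proof.
move=> /andP[t0 t1].
have sE : (Num.sqrt t)^-1 = expR (- ln t / 2).
  have -> : t = expR (ln t / 2) ^+ 2.
    by rewrite -expRM_natr divfK // lnK.
  rewrite sqrtr_sqr ger0_norm ?expR_ge0 // -expRN; congr expR.
  by rewrite -expRM_natr divfK // expRK mulNr.
have l0 : 0 <= - ln t / 2 by rewrite divr_ge0 // oppr_ge0 ln_le0.
rewrite sE; case: k => [|k].
  by rewrite !expr0 fact0 !mul1r -[leLHS]expR0 ler_expR.
have := expR_ge1Dxn k l0.
rewrite expr_div_n => H.
have {H} : (- ln t) ^+ k.+1 / 2 ^+ k.+1 / k.+1`!%:R <= expR (- ln t / 2).
  by apply: le_trans H; rewrite lerDr.
rewrite !ler_pdivrMr ?exprn_gt0 ?ltr0n ?fact_gt0 // => /le_trans; apply.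
by rewrite mulrC [expR _ * _]mulrC mulrA.
Qed.

Lemma ln_le0_itv t : 0 < t <= 1 -> 0 <= - ln t.
Proof. by move=> /andP[_ t1]; rewrite oppr_ge0 ln_le0. Qed.

Lemma measurable_ln_pow k : measurable_fun `](0:R), 1] (fun t : R => (- ln t) ^+ k).
Proof.
apply: measurable_funX; apply: measurableT_comp => //.
exact: measurable_funTS.
Qed.

Lemma measurable_oc01 : measurable (`]0, 1]%classic : set (measurableTypeR R)).
Proof. exact: measurable_itv. Qed.

Lemma integrable_ln_pow k : mu.-integrable `]0, 1] (EFin \o (fun t => (- ln t) ^+ k)).
Proof.
have := integrableZl measurable_oc01 (2 ^+ k * k`!%:R) integrable_invsqrt.
apply: le_integrable => //.
  by apply/measurable_EFinP; exact: measurable_ln_pow.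
move=> t /=; rewrite in_itv /= => t01; rewrite lee_fin.
rewrite ger0_norm ?exprn_ge0 ?ln_le0_itv // (le_trans (ln_pow_le _ t01)) //.
exact: ler_norm.
Qed.

Lemma integrable_dominated f (M : R) k :
  measurable_fun `](0:R), 1] f ->
  (forall t, 0 < t <= 1 -> `|f t| <= M * (- ln t) ^+ k) ->
  mu.-integrable `]0, 1] (EFin \o f).
Proof.
move=> mf fM; have := integrableZl measurable_oc01 M (integrable_ln_pow k).
apply: le_integrable => //; first exact/measurable_EFinP.
move=> t /=; rewrite in_itv /= => t01; rewrite lee_fin.
by rewrite (le_trans (fM t t01)) // ler_norm.
Qed.

Lemma integrable_oc_cc f : mu.-integrable `]0, 1] (EFin \o f) ->
  mu.-integrable `[0, 1] (EFin \o f).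
Proof.
move=> itf; apply/(@negligible_integrable _ _ _ mu _ [set 0]) => //.
- apply/emeasurable_fun_itv_obnd_cbndP.
  by case/integrableP : itf.
- exact: lebesgue_measure_set1.
- by rewrite setDitv1l.
Qed.

(* An improper fundamental theorem of calculus: [F] extends continuously by
   [0] at [0], but [f] may be unbounded there. *)
Lemma Rintegral_is_derive F f :
  mu.-integrable `]0, 1] (EFin \o f) ->
  (forall t, 0 < t <= 1 -> is_derive t 1 F (f t)) ->
  (forall t, 0 < t <= 1 -> derivable f t 1) ->
  F t @[t --> 0^'+] --> 0 ->
  \int[mu]_(t in `]0, 1]) f t = F 1.
Proof.
move=> itf dF df F0; rewrite Rintegral_itv_obnd_cbnd //.
have itf' := integrable_oc_cc itf.
apply/eqP; rewrite -subr_eq0 -normr_le0; apply/ler_addgt0Pr => e e0; rewrite add0r.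
have e2 : 0 < e / 2 by rewrite divr_gt0.
have P2 : \forall c \near (0 : R)^'+, `|F c| < e / 2.
  by apply: cvgr0_norm_lt.
(* A cut point where the integral over [0, c] and the value of [F] are both small; the ordinary
   fundamental theorem applies on [c, 1]. *)
have [c [c01 Ic Fc]] : exists c : R, [/\ 0 < c < 1,
    `|\int[mu]_(t in `[0, c]) f t| < e / 2 & `|F c| < e / 2].
  near (0 : R)^'+ => c; exists c; split.
  - by apply/andP; split; near: c; [exact: nbhs_right_gt|exact: nbhs_right_lt].
  - have c0 : 0 <= c by near: c; exact: nbhs_right_ge.
    move: c0; near: c; apply: cvg_within.
    exact: (parameterized_integral_near_left ltr01 e2 itf').
  - by near: c.
have [c0 c1] := andP c01.
have sub t : c <= t <= 1 -> 0 < t <= 1.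
  by move=> /andP[ct ->]; rewrite (lt_le_trans c0 ct).
have H1 t : c <= t <= 1 -> is_derive t 1 F (f t) by move=> /sub /dF.
have H2 t : c <= t <= 1 -> derivable f t 1 by move=> /sub /df.
have E1 : \int[mu]_(t in `[c, 1]) f t = F 1 - F c.
  by rewrite /Rintegral (integral_is_derive c1 H1 H2).
have itc : mu.-integrable `]c, 1] (EFin \o f).
  by apply: integrableS itf' => //; apply: subset_itvr; rewrite bnd_simp ltW.
have := @Rintegral_itvB R f (BLeft 0) (BRight 1) c itf'.
rewrite !bnd_simp (Rintegral_itv_obnd_cbnd itc) E1 => /(_ (ltW c0) (ltW c1)) E2.
have -> : \int[mu]_(t in `[0, 1]) f t - F 1 = \int[mu]_(t in `[0, c]) f t - F c.
  by move: E2; lra.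
apply: le_trans (ler_normB _ _) _; rewrite [leRHS](splitr e).
by apply: lerD; exact: ltW.
Unshelve. all: by end_near. Qed.

End RealIntegrals.

(** * Complex integrals and the differential equations of S_{n,p} *)

Section ComplexIntegrals.
Variable R : realType.
Local Notation C := R[i].
Local Notation Re := complex.Re.
Local Notation Im := complex.Im.
Local Notation normc := ComplexField.Normc.normc.
Implicit Types (f g : R -> C) (t : R) (a u w z : C).
Notation mu := (@lebesgue_measure R).

Definition path_diff f t := exists u, path_derive f t u.

Lemma derivable_path_diff f t : derivable (fun s => Re (f s)) t 1 ->
  derivable (fun s => Im (f s)) t 1 -> path_diff f t.
Proof.
by move=> /derivableP fr /derivableP fi; eexists (_ +i* _); split;
  [exact: fr|exact: fi].
Qed.

Lemma path_diffM f g t : path_diff f t -> path_diff g t ->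
  path_diff (fun s => f s * g s) t.
Proof. by move=> [u fu] [v gv]; exists (f t * v + u * g t); exact: path_deriveM fu gv. Qed.

Lemma path_deriveX f t u n : path_derive f t u ->
  path_derive (fun s => f s ^+ n.+1) t (n.+1%:R * f t ^+ n * u).
Proof.
move=> fu; elim: n => [|n IH]; first by rewrite expr0 !mul1r.
rewrite (_ : (fun s => _) = (fun s => f s * f s ^+ n.+1)); last first.
  by apply/funext => s; rewrite exprS.
by apply: (path_derive_eq (path_deriveM fu IH)); rewrite !exprS -[n.+2%:R]natr1; ring.
Qed.

Lemma path_diffX f t n : path_diff f t -> path_diff (fun s => f s ^+ n) t.
Proof.
move=> [u fu]; case: n => [|n]; last by eexists; exact: (path_deriveX n fu).
by exists 0; under eq_fun do rewrite expr0; exact: path_derive_cst.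
Qed.

Lemma path_derive_real (r : R -> R) t d : is_derive t 1 r d ->
  path_derive (fun s => (r s)%:C) t d%:C.
Proof. by move=> rd; split => //=; exact: is_derive_cst. Qed.

Lemma path_diffV f t : f t != 0 -> path_diff f t -> path_diff (fun s => (f s)^-1) t.
Proof.
move=> f0 [u [fr fi]].
have q0 : ((fun s => Re (f s)) ^+ 2 + (fun s => Im (f s)) ^+ 2) t != 0.
  rewrite /= paddr_eq0 ?sqr_ge0 // negb_and !sqrf_eq0.
  by apply: contraNT f0; rewrite negb_or !negbK => /andP[/eqP r0 /eqP i0]; apply/eqP/complex_eqP.
have [dq _] := is_deriveV q0 (is_deriveD (is_deriveX 2 fr) (is_deriveX 2 fi)).
case: fr fi => [fr _] [fi _]; apply: derivable_path_diff.
  under eq_fun do rewrite cReV.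
  exact: (derivableM fr dq).
under eq_fun do rewrite cImV.
exact: (derivableM (derivableN fi) dq).
Qed.

Lemma path_diff_ln t : 0 < t -> path_diff (fun s => (ln s)%:C) t.
Proof. by move=> t0; eexists; apply: path_derive_real; exact: is_derive1_ln. Qed.

Lemma path_diff_real t : path_diff (fun s => s%:C) t.
Proof. by eexists; apply: path_derive_real; exact: is_derive_id. Qed.

(** Half-open at 0, where [ln t] and the division by [t] have only default values; [Cintegral01E]
    identifies it with the closed version. *)
Definition cint f : C :=
  (\int[mu]_(t in `]0, 1]) Re (f t)) +i* (\int[mu]_(t in `]0, 1]) Im (f t)).

Definition cintegrable f :=
  mu.-integrable `]0, 1] (EFin \o (fun t => Re (f t))) /\
  mu.-integrable `]0, 1] (EFin \o (fun t => Im (f t))).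

Lemma Cintegral01E f : cintegrable f -> Cintegral01 f = cint f.
Proof.
by move=> [fr fi]; rewrite /Cintegral01 /cint !Rintegral_itv_obnd_cbnd.
Qed.

Lemma cintegrable_dominated f (M : R) k :
  (forall t, 0 < t <= 1 -> path_diff f t) ->
  (forall t, 0 < t <= 1 -> normc (f t) <= M * (- ln t) ^+ k) -> cintegrable f.
Proof.
move=> df fM; split; apply: (@integrable_dominated _ _ M k).
- by apply: derivable_measurable => t /df[u [[]]].
- by move=> t /fM; exact: le_trans (normc_ge_Re _).
- by apply: derivable_measurable => t /df[u [_ []]].
- by move=> t /fM; exact: le_trans (normc_ge_Im _).
Qed.

Lemma integrable_scale (r : R) (f : R -> R) :
  mu.-integrable `]0, 1] (EFin \o f) ->
  mu.-integrable `]0, 1] (EFin \o (fun t => r * f t)).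
Proof.
move=> itf; have := integrableZl (@measurable_oc01 R) r itf.
by apply: eq_integrable => // t _ /=; rewrite EFinM.
Qed.

Lemma integrable_sub (f g : R -> R) :
  mu.-integrable `]0, 1] (EFin \o f) -> mu.-integrable `]0, 1] (EFin \o g) ->
  mu.-integrable `]0, 1] (EFin \o (fun t => f t - g t)).
Proof.
move=> itf itg; have := integrableB (@measurable_oc01 R) itf itg.
by apply: eq_integrable => // t _ /=; rewrite EFinB.
Qed.

Lemma integrable_add (f g : R -> R) :
  mu.-integrable `]0, 1] (EFin \o f) -> mu.-integrable `]0, 1] (EFin \o g) ->
  mu.-integrable `]0, 1] (EFin \o (fun t => f t + g t)).
Proof.
move=> itf itg; have := integrableD (@measurable_oc01 R) itf itg.
by apply: eq_integrable => // t _ /=; rewrite EFinD.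
Qed.

Lemma cintZ w f : cintegrable f -> cint (fun t => w * f t) = w * cint f.
Proof.
move=> [fr fi]; apply: complex_eqP => /=.
  under eq_Rintegral => t _ do rewrite cReM.
  rewrite RintegralB //; last 2 first.
  - exact: integrable_scale.
  - exact: integrable_scale.
  by rewrite !RintegralZl // cReM.
under eq_Rintegral => t _ do rewrite cImM.
rewrite RintegralD //; last 2 first.
- exact: integrable_scale.
- exact: integrable_scale.
by rewrite !RintegralZl // cImM.
Qed.

Lemma cintegrableZ w f : cintegrable f -> cintegrable (fun t => w * f t).
Proof.
move=> [fr fi]; split.
  have -> : (fun t => Re (w * f t)) = (fun t => Re w * Re (f t) - Im w * Im (f t)).
    by apply/funext => t; rewrite cReM.
  by apply: integrable_sub; exact: integrable_scale.
have -> : (fun t => Im (w * f t)) = (fun t => Re w * Im (f t) + Im w * Re (f t)).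
  by apply/funext => t; rewrite cImM.
by apply: integrable_add; exact: integrable_scale.
Qed.

Lemma cintB f g : cintegrable f -> cintegrable g ->
  cint (fun t => f t - g t) = cint f - cint g.
Proof.
move=> [fr fi] [gr gi]; apply: complex_eqP; rewrite ?cReB ?cImB /=.
  by under eq_Rintegral => t _ do rewrite cReB; rewrite RintegralB.
by under eq_Rintegral => t _ do rewrite cImB; rewrite RintegralB.
Qed.

Lemma cintegrableB f g : cintegrable f -> cintegrable g ->
  cintegrable (fun t => f t - g t).
Proof.
move=> [fr fi] [gr gi]; split.
  have -> : (fun t => Re (f t - g t)) = (fun t => Re (f t) - Re (g t)).
    by apply/funext => t; rewrite cReB.
  exact: integrable_sub.
have -> : (fun t => Im (f t - g t)) = (fun t => Im (f t) - Im (g t)).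
  by apply/funext => t; rewrite cImB.
exact: integrable_sub.
Qed.

Lemma Rintegral_dominated (f : R -> R) (M : R) k :
  mu.-integrable `]0, 1] (EFin \o f) ->
  (forall t, 0 < t <= 1 -> `|f t| <= M * (- ln t) ^+ k) ->
  `|\int[mu]_(t in `]0, 1]) f t| <= M * \int[mu]_(t in `]0, 1]) (- ln t) ^+ k.
Proof.
move=> itf fM; apply: le_trans (le_normr_Rintegral (@measurable_oc01 R) itf) _.
rewrite -RintegralZl //; last exact: integrable_ln_pow.
apply: le_Rintegral => //.
- exact: integrable_norm.
- exact: (integrable_scale M (@integrable_ln_pow R k)).
Qed.

Lemma normc_cint f (M : R) k : cintegrable f ->
  (forall t, 0 < t <= 1 -> normc (f t) <= M * (- ln t) ^+ k) ->
  normc (cint f) <= 2 * (M * \int[mu]_(t in `]0, 1]) (- ln t) ^+ k).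
Proof.
move=> [fr fi] fM; apply: le_trans (normc_le_ReIm _) _; rewrite mulr_natl mulr2n.
apply: lerD; apply: Rintegral_dominated => // t /fM; apply: le_trans.
  exact: normc_ge_Re.
exact: normc_ge_Im.
Qed.

Lemma cint_path_derive f g : cintegrable g ->
  (forall t, 0 < t <= 1 -> path_derive f t (g t)) ->
  (forall t, 0 < t <= 1 -> path_diff g t) ->
  normc (f t) @[t --> 0^'+] --> 0 -> cint g = f 1.
Proof.
move=> [gr gi] df dg f0.
have f0' (r : C -> R) : (forall w, `|r w| <= normc w) -> r (f t) @[t --> 0^'+] --> 0.
  move=> rw; apply/cvgr0Pnorm_le => e e0.
  have P : \forall t \near (0 : R)^'+, `|normc (f t)| <= e by apply: cvgr0_norm_le.
  near=> t.
  apply: le_trans (rw _) _; apply: le_trans (ler_norm _) _.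
  by near: t.
apply: complex_eqP => /=.
  apply: (@Rintegral_is_derive R (fun t => Re (f t))) => //.
  - by move=> t /df[].
  - by move=> t /dg[u [[]]].
  - by apply: f0'; exact: normc_ge_Re.
apply: (@Rintegral_is_derive R (fun t => Im (f t))) => //.
- by move=> t /df[].
- by move=> t /dg[u [_ []]].
- by apply: f0'; exact: normc_ge_Im.
Unshelve. all: by end_near. Qed.

Lemma path_derive_Clog_cut z t : cut1 z -> 0 < t <= 1 ->
  path_derive (fun s => Clog (1 - z * s%:C)) t (- z / (1 - z * t%:C)).
Proof.
move=> cz /andP[t0 t1]; have sl : slit_plane (1 - z * t%:C).
  by apply: cut1_slit => //; rewrite ltW.
have -> : (fun s : R => Clog (1 - z * s%:C)) = fun s => Clog (1 + s%:C * - z).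
  by apply/funext => s; congr Clog; ring.
have E : 1 - z * t%:C = 1 + t%:C * - z by ring.
by rewrite E in sl *; apply: path_derive_Clog => //; exact: path_derive_line.
Qed.

Section Kernels.
Variables (k p : nat).

Definition kernel z t : C :=
  (ln t)%:C ^+ k * Clog (1 - z * t%:C) ^+ p.+1 / t%:C.

(** The z-derivative of [kernel]: the inner derivative -t of 1 - zt cancels the denominator t. *)
Definition dkernel z t : C :=
  (ln t)%:C ^+ k * (p.+1%:R * Clog (1 - z * t%:C) ^+ p * - (1 - z * t%:C)^-1).

Lemma cut1_neq0 z t : cut1 z -> 0 < t <= 1 -> 1 - z * t%:C != 0.
Proof.
move=> cz /andP[t0 t1].
have /slit_planeP : slit_plane (1 - z * t%:C) by apply: cut1_slit => //; rewrite ltW.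
by move=> sl; apply/eqP => E; rewrite E /= ltxx eqxx in sl; case: sl.
Qed.

Lemma path_diff_kernel z t : cut1 z -> 0 < t <= 1 -> path_diff (kernel z) t.
Proof.
move=> cz t01; have t0 : 0 < t by case/andP: t01.
apply: path_diffM; last first.
  apply: path_diffV; last exact: path_diff_real.
  by rewrite eq_complex /= gt_eqF.
apply: path_diffM; first by apply: path_diffX; exact: path_diff_ln.
by apply: path_diffX; eexists; exact: path_derive_Clog_cut.
Qed.

Lemma path_diff_dkernel z t : cut1 z -> 0 < t <= 1 -> path_diff (dkernel z) t.
Proof.
move=> cz t01; have t0 : 0 < t by case/andP: t01.
apply: path_diffM; first by apply: path_diffX; exact: path_diff_ln.
apply: path_diffM; first apply: path_diffM.
- by exists 0; exact: path_derive_cst.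
- by apply: path_diffX; eexists; exact: path_derive_Clog_cut.
have -> : (fun s : R => - (1 - z * s%:C)^-1) = fun s => - 1 * (1 + s%:C * - z)^-1.
  by apply/funext => s; rewrite mulN1r; congr (- _^-1); ring.
apply: path_diffM; first by exists 0; exact: path_derive_cst.
apply: path_diffV; last by eexists; exact: path_derive_line.
by rewrite mulrN -mulNr [_ * z]mulrC mulrN; exact: cut1_neq0.
Qed.

Lemma normc_ln_pow t : 0 < t <= 1 -> normc ((ln t)%:C ^+ k) = (- ln t) ^+ k.
Proof.
move=> t01; rewrite normcX normc_real ler0_norm //.
by rewrite -oppr_ge0 ln_le0_itv.
Qed.

Lemma normc_kernel z : cut1 z -> exists M : R, forall t, 0 < t <= 1 ->
  normc (kernel z t) <= M * (- ln t) ^+ k.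
Proof.
move=> cz; have [d [K [d0 K1 H]]] := Clog_unif cz.
exists (K ^+ p.+1) => t t01; case/andP: (t01) => t0 t1.
have [] := H 0 t; rewrite ?ComplexField.Normc.normc0 ?(ltW t0) ?(ltW d0) // addr0.
move=> LK _ _; rewrite /kernel -mulrA ComplexField.Normc.normcM normc_ln_pow //.
rewrite mulrC ler_wpM2r ?exprn_ge0 ?ln_le0_itv //.
rewrite ComplexField.Normc.normcM ComplexField.Normc.normcV normc_real normcX.
rewrite ger0_norm ?(ltW t0) // ler_pdivrMr //.
have K0 : 0 <= K by lra.
apply: (@le_trans _ _ ((K * t) ^+ p.+1)).
  by rewrite lerXn2r ?nnegrE ?normc_ge0 ?mulr_ge0 ?(ltW t0).
by rewrite exprMn ler_wpM2l ?exprn_ge0 // exprS ler_piMr ?exprn_ile1 ?(ltW t0).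
Qed.

Lemma normc_dkernel z : cut1 z -> exists M : R, forall t, 0 < t <= 1 ->
  normc (dkernel z t) <= M * (- ln t) ^+ k.
Proof.
move=> cz; have [d [K [d0 K1 H]]] := Clog_unif cz.
have [e e0 He] := cut1_dist cz; have K0 : 0 <= K by lra.
exists (p.+1%:R * K ^+ p * e^-1) => t t01; case/andP: (t01) => t0 t1.
have [] := H 0 t; rewrite ?ComplexField.Normc.normc0 ?(ltW t0) ?(ltW d0) // addr0.
move=> LK _ _; rewrite /dkernel ComplexField.Normc.normcM normc_ln_pow //.
rewrite mulrC ler_wpM2r ?exprn_ge0 ?ln_le0_itv //.
rewrite ComplexField.Normc.normcM normcN; apply: ler_pM; rewrite ?normc_ge0 //.
  rewrite ComplexField.Normc.normcM normc_nat normcX ler_wpM2l //.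
  rewrite lerXn2r ?nnegrE ?normc_ge0 // (le_trans LK) // ler_piMr //.
by apply: normcV_le => //; apply: He; rewrite (ltW t0).
Qed.

Lemma cintegrable_kernel z : cut1 z -> cintegrable (kernel z).
Proof.
move=> cz; have [M HM] := normc_kernel cz.
by apply: cintegrable_dominated HM => t; exact: path_diff_kernel.
Qed.

Lemma cintegrable_dkernel z : cut1 z -> cintegrable (dkernel z).
Proof.
move=> cz; have [M HM] := normc_dkernel cz.
by apply: cintegrable_dominated HM => t; exact: path_diff_dkernel.
Qed.

(** Pointwise the remainder is at most B |h|^2 (-ln t)^k, so after integration it is at most a fixed
    multiple of |h|^2. *)
Lemma cint_kernel_derive z : cut1 z ->
  is_derive (z : C^o) 1 ((fun w => cint (kernel w)) : C^o -> C^o) (cint (dkernel z)).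
Proof.
move=> cz; have [d [K [d0 K1 H]]] := Clog_unif cz.
have [e e0 He] := cut1_nbhs cz.
have [B B0 HB] := expr_quadratic p K1.
apply: (@quadratic_is_derive _ _ _ _ (Num.min (Num.min 1 d) e)
   (2 * (B * \int[mu]_(t in `]0, 1]) (- ln t) ^+ k))).
  by rewrite !lt_min ltr01 d0.
move=> h; rewrite !lt_min => /andP[/andP[h1 hd] he].
have czh := He h he.
have I1 := cintegrable_kernel czh; have I2 := cintegrable_kernel cz.
have I3 := cintegrable_dkernel cz.
have I12 := cintegrableB I1 I2; have Ih := cintegrableZ h I3.
rewrite -cintZ // -cintB // -cintB //.
have -> : 2 * (B * \int[mu]_(t in `]0, 1]) (- ln t) ^+ k) * normc h ^+ 2 =
  2 * ((B * normc h ^+ 2) * \int[mu]_(t in `]0, 1]) (- ln t) ^+ k) by ring.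
apply: normc_cint; first exact: cintegrableB.
move=> t t01; case/andP: (t01) => t0 t1.
have tc : t%:C != 0 :> C by rewrite eq_complex /= gt_eqF.
have t01' : 0 <= t <= 1 by rewrite ltW.
have A1 : normc (Clog (1 - z * t%:C)) <= K * t.
  have := H 0 t; rewrite addr0 ComplexField.Normc.normc0.
  by move=> /(_ (ltW d0) t01')[].
have [A2 A3 A4] := H h t (ltW hd) t01'.
have A3' : normc (- (t%:C / (1 - z * t%:C))) <= K * t by rewrite normcN.
have := HB _ _ _ h t t01' (ltW h1) A2 A1 A3' A4.
set E := _ - h * _ => HE.
have -> : kernel (z + h) t - kernel z t - h * dkernel z t =
    (ln t)%:C ^+ k * (t%:C^-1 * E).
  rewrite /kernel /dkernel /E; field.
  by rewrite tc cut1_neq0.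
rewrite ComplexField.Normc.normcM normc_ln_pow // mulrC.
rewrite ler_wpM2r ?exprn_ge0 ?ln_le0_itv //.
rewrite ComplexField.Normc.normcM ComplexField.Normc.normcV normc_real.
by rewrite ger0_norm ?(ltW t0) // mulrC ler_pdivrMr // -mulrA.
Qed.

End Kernels.

(** By [ln_pow_le] the majorant is O(sqrt t). This kills the boundary term at 0 in the integrations
    by parts. *)
Lemma cvg_t_ln_pow k (M : R) (f : R -> R) :
  (forall t, 0 < t <= 1 -> 0 <= f t <= M * t * (- ln t) ^+ k) ->
  f t @[t --> 0^'+] --> 0.
Proof.
move=> Hf; pose L := `|M| * (2 ^+ k * k`!%:R).
have cs : (L * Num.sqrt t) @[t --> (0 : R)^'+] --> 0.
  rewrite -[X in _ --> X](mulr0 L); apply: cvgM; first exact: cvg_cst.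
  have := @sqrt_continuous R 0; rewrite /continuous_at sqrtr0 => h.
  exact: cvg_at_right_filter h.
apply: (squeeze_cvgr _ _ cs); last exact: cvg_cst.
near=> t.
have t01 : 0 < t <= 1.
  apply/andP; split; near: t; [exact: nbhs_right_gt|exact: nbhs_right_le].
have /andP[-> fM] := Hf t t01; apply: le_trans fM _.
have /andP[t0 _] := t01.
have s0 : Num.sqrt t != 0 by rewrite gt_eqF ?sqrtr_gt0.
apply: (@le_trans _ _ (`|M| * t * (2 ^+ k * k`!%:R / Num.sqrt t))).
  apply: (@le_trans _ _ (`|M| * t * (- ln t) ^+ k)).
    rewrite ler_wpM2r ?exprn_ge0 ?ln_le0_itv // ler_wpM2r ?(ltW t0) //.
    exact: ler_norm.
  rewrite ler_wpM2l ?mulr_ge0 ?(ltW t0) //; exact: ln_pow_le.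
have {1}-> : t = Num.sqrt t * Num.sqrt t by rewrite -expr2 sqr_sqrtr // ltW.
rewrite le_eqVlt; apply/orP; left; apply/eqP; rewrite /L; field.
Unshelve. all: by end_near. Qed.

Lemma path_diffB f g t : path_diff f t -> path_diff g t ->
  path_diff (fun s => f s - g s) t.
Proof.
move=> [u [[fr _] [fi _]]] [v [[gr _] [gi _]]]; apply: derivable_path_diff.
  have -> : (fun s => Re (f s - g s)) = (fun s => Re (f s)) - (fun s => Re (g s)).
    by apply/funext => s; rewrite cReB.
  exact: (derivableB fr gr).
have -> : (fun s => Im (f s - g s)) = (fun s => Im (f s)) - (fun s => Im (g s)).
  by apply/funext => s; rewrite cImB.
exact: (derivableB fi gi).
Qed.

Lemma cvg_ln_pow_Clog k p z : cut1 z ->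
  normc ((ln t)%:C ^+ k * Clog (1 - z * t%:C) ^+ p.+1) @[t --> 0^'+] --> 0.
Proof.
move=> cz; have [d [K [d0 K1 H]]] := Clog_unif cz.
apply: (@cvg_t_ln_pow k (K ^+ p.+1)) => t t01; rewrite normc_ge0 /=.
have [t0 t1] := andP t01.
have LK : normc (Clog (1 - z * t%:C)) <= K * t.
  have := H 0 t; rewrite addr0 ComplexField.Normc.normc0 (ltW t0) t1.
  by move=> /(_ (ltW d0) isT)[].
have K0 : 0 <= K by lra.
rewrite ComplexField.Normc.normcM normc_ln_pow // mulrC.
rewrite ler_wpM2r ?exprn_ge0 ?ln_le0_itv // normcX.
apply: (@le_trans _ _ ((K * t) ^+ p.+1)).
  by rewrite lerXn2r ?nnegrE ?normc_ge0 ?mulr_ge0 ?(ltW t0).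
by rewrite exprMn ler_wpM2l ?exprn_ge0 // exprS ler_piMr ?exprn_ile1 ?(ltW t0).
Qed.

(** The integrand on the left is the t-derivative of Clog (1 - zt)^(p+1), which tends to 0 with
    t. *)
Lemma dkernel0 p z : cut1 z -> z * cint (dkernel 0 p z) = Clog (1 - z) ^+ p.+1.
Proof.
move=> cz; rewrite -cintZ; last exact: cintegrable_dkernel.
rewrite (@cint_path_derive (fun t => Clog (1 - z * t%:C) ^+ p.+1)).
- by rewrite mulr1.
- by apply: cintegrableZ; exact: cintegrable_dkernel.
- move=> t t01.
  apply: (path_derive_eq (path_deriveX p (path_derive_Clog_cut cz t01))).
  by rewrite /dkernel expr0; ring.
- move=> t t01; apply: path_diffM; last exact: path_diff_dkernel.
  by exists 0; exact: path_derive_cst.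
- have := cvg_ln_pow_Clog 0 p cz.
  by under eq_fun do rewrite expr0 mul1r.
Qed.

(** The t-derivative of (ln t)^(k+1) Clog (1 - zt)^(p+1) is z [dkernel] plus (k+1) [kernel]; its
    boundary value at 1 vanishes because ln 1 = 0. *)
Lemma dkernelS k p z : cut1 z ->
  z * cint (dkernel k.+1 p z) = - k.+1%:R * cint (kernel k p z).
Proof.
move=> cz; have I1 := cintegrable_dkernel k.+1 p cz.
have I2 := cintegrable_kernel k p cz.
rewrite -cintZ // -cintZ //; apply/eqP; rewrite -subr_eq0 -cintB; last 2 first.
- exact: cintegrableZ.
- exact: cintegrableZ.
rewrite (@cint_path_derive (fun t => (ln t)%:C ^+ k.+1 * Clog (1 - z * t%:C) ^+ p.+1)).
- by rewrite ln1 exprS mul0r mul0r.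
- by apply: cintegrableB; apply: cintegrableZ.
- move=> t t01; have /andP[t0 _] := t01.
  have d1 := path_deriveX k (path_derive_real (is_derive1_ln t0)).
  apply: (path_derive_eq (path_deriveM d1 (path_deriveX p (path_derive_Clog_cut cz t01)))).
  by rewrite /dkernel /kernel rmorphV ?unitfE ?gt_eqF //; ring.
- move=> t t01.
  have cd (w : C) : path_diff (fun=> w) t by exists 0; exact: path_derive_cst.
  apply: path_diffB; apply: path_diffM => //; first exact: path_diff_dkernel.
  exact: path_diff_kernel.
- exact: cvg_ln_pow_Clog.
Qed.

Lemma nielsenE k p z : cut1 z -> nielsen k.+1 p.+1 z =
  (-1) ^+ (k + p.+1)%N / (k`! * p.+1`!)%:R * cint (kernel k p z).
Proof.
move=> cz; rewrite /nielsen /= !subn1 /=.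
by rewrite Cintegral01E //; exact: cintegrable_kernel.
Qed.

Lemma near_cut1 z : cut1 z -> \forall w \near (z : C^o), cut1 w.
Proof.
move=> cz; have [d d0 H] := cut1_nbhs cz.
apply/nbhs_ballP; exists d%:C; first by rewrite /= ltcR.
move=> w; rewrite -ball_normE /= => zw.
rewrite -[w](subrK z) addrC; apply: H; rewrite -ltcR -normcE.
by rewrite distrC.
Qed.

Lemma nielsen_derive k p z : cut1 z -> z != 0 ->
  is_derive (z : C^o) 1 (nielsen k.+1 p.+1 : C^o -> C^o) (nielsen k p.+1 z / z).
Proof.
move=> cz z0.
have D := is_deriveZ ((-1) ^+ (k + p.+1)%N / (k`! * p.+1`!)%:R : C)
   (cint_kernel_derive k p cz).
apply: (near_eq_is_derive _ (is_derive_eq D _)).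
  near=> w; have cw : cut1 w by near: w; exact: near_cut1.
  by rewrite nielsenE.
rewrite /GRing.scale /=; case: k D => [|k] D.
  (* For k = 0 the target is S_{0,p}, defined by its convention and not by an integral. *)
  rewrite /nielsen /= -dkernel0 // add0n mul1n.
  by rewrite -[RHS]mulrA [z * _]mulrC mulfK.
rewrite nielsenE //; apply: (mulIf z0); rewrite -[in LHS]mulrA [_ * z]mulrC dkernelS //.
rewrite divfK // addSn exprS factS !natrM; field.
by rewrite -/(factorial p) !nat1r !pnatr_eq0 -!lt0n !fact_gt0.
Unshelve. all: by end_near. Qed.

Lemma Clog_onem_derive z : cut1 z ->
  is_derive (z : C^o) 1 ((fun w => Clog (1 - w)) : C^o -> C^o) (- (1 - z)^-1).
Proof.
move=> cz; have [d [K [d0 K1 H]]] := Clog_unif cz.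
apply: (@quadratic_is_derive _ _ _ _ d K) => // h hd.
have h01 : (0 <= (1 : R)) && ((1 : R) <= 1) by rewrite ler01 lexx.
have [_ _] := H h 1 (ltW hd) h01.
by rewrite !mulr1 mul1r.
Qed.

Lemma nielsen0_derive p z : cut1 z ->
  is_derive (z : C^o) 1 (nielsen 0 p.+1 : C^o -> C^o) (nielsen 0 p z / (1 - z)).
Proof.
move=> cz; have z1 : 1 - z != 0.
  by have := @cut1_neq0 z 1 cz; rewrite mulr1; apply; rewrite ltr01 /=.
have D := is_deriveZ ((-1) ^+ p.+1 / (p.+1)`!%:R : C)
  (is_deriveX p.+1 (Clog_onem_derive cz)).
have -> : nielsen 0 p.+1 =
    ((-1) ^+ p.+1 / (p.+1)`!%:R : C) \*: (fun w : C^o => Clog (1 - w) : C^o) ^+ p.+1.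
  by apply/funext => w; rewrite /= exprfctE.
apply: (is_derive_eq D); rewrite /nielsen /= /GRing.scale /= exprS factS natrM.
by field; rewrite z1 -/(factorial p) nat1r !pnatr_eq0 -!lt0n fact_gt0.
Qed.

End ComplexIntegrals.

(** * Symbols on the letters z and 1 - z *)

Section NielsenSymbols.
Variable R : realType.
Local Notation C := R[i].
Local Notation words := (words R).
Local Notation U := (@cut_plane R).
Implicit Types (F G : C -> C) (s t : words) (z : C).

Lemma letter_X_neq0 : tofrac 'X != 0 :> ratfun R.
Proof. by rewrite tofrac_eq0 polyX_eq0. Qed.

Lemma onem_X_neq0 : 1 - 'X != 0 :> {poly C}.
Proof. by rewrite -oppr_eq0 opprB polyXsubC_eq0. Qed.

Lemma letter_onem_neq0 : tofrac (1 - 'X) != 0 :> ratfun R.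
Proof. by rewrite tofrac_eq0 onem_X_neq0. Qed.

Definition lz : letter R := exist _ (tofrac 'X) letter_X_neq0.
Definition lonem : letter R := exist _ (tofrac (1 - 'X)) letter_onem_neq0.

Lemma cut_planeP z : U z -> [/\ z != 0, 1 - z != 0, cut1 z, cut1 (1 - z) & cut1 (1 - z^-1)].
Proof.
rewrite /cut_plane /= => /andP[z0 z1].
have zn0 : z != 0 by apply: contraNneq z0 => ->.
split => //.
- by rewrite subr_eq0; apply: contraNneq z1 => <-.
- by rewrite /cut1 /= lerBrDr -lerBrDl subrr.
- by rewrite /cut1 /= lerBrDr -lerBrDl subrr invr_le0.
Qed.

Lemma is_dlog_lz : is_dlog U lz (fun z => z^-1).
Proof.
exists 'X, 1; split; first by rewrite tofrac1 divr1.
move=> z /cut_planeP[z0 _ _ _ _]; rewrite hornerX hornerC oner_eq0; split => //.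
by rewrite derivX !hornerC div1r derivC hornerC mul0r subr0.
Qed.

Lemma is_dlog_lonem : is_dlog U lonem (fun z => - (1 - z)^-1).
Proof.
exists (1 - 'X), 1; split; first by rewrite tofrac1 divr1.
move=> z /cut_planeP[_ z1 _ _ _]; rewrite !hornerE oner_eq0; split => //.
by rewrite derivB derivX !derivC !hornerE subr0 mulN1r.
Qed.

(* [xsymb N F s] restricts [is_symb] to symbols on the two letters [z] and
   [1 - z]; unlike [is_symb] it is visibly closed under linear combinations. *)
Fixpoint xsymb N F s : Prop :=
  match N with
  | 0 => exists q : rat, (forall z, U z -> F z = ratr q) /\ s = << q *g [::] >>
  | M.+1 => exists A B : C -> C, exists a b : words,
      [/\ xsymb M A a, xsymb M B b,
        forall z, U z -> is_derive (z : C^o) 1 (F : C^o -> C^o)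
          (A z * z^-1 + B z * - (1 - z)^-1) &
        s = trcons lz a + trcons lonem b]
  end.

Lemma xsymb_is_symb N F s : xsymb N F s -> is_symb U N F s.
Proof.
elim: N F s => [|N IH] F s /=; first by move=> [q [Fq ->]]; exact: is_symb0.
move=> [A [B [a [b [sA sB dF ->]]]]].
pose pick (T : Type) (u v : T) (i : 'I_2) : T := if i == ord0 then u else v.
have -> : trcons lz a + trcons lonem b =
    \sum_(i < 2) tensor_rcons (pick _ a b i) (pick _ lz lonem i) :> words.
  by rewrite big_ord_recl big_ord1.
apply: (@is_symbS _ _ _ _ _ (pick _ A B) _ _
  (pick _ (fun z => z^-1) (fun z => - (1 - z)^-1))).
- by move=> i; rewrite /pick; case: ifP => _; exact: IH.
- by move=> i; rewrite /pick; case: ifP => _; [exact: is_dlog_lz|exact: is_dlog_lonem].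
- by move=> z Uz; rewrite big_ord_recl big_ord1; exact: dF.
Qed.

Lemma xsymb0 N : xsymb N (fun=> 0) 0.
Proof.
elim: N => [|N IH] /=; first by exists 0; split; rewrite ?freegU0 // => z _; rewrite rmorph0.
exists (fun=> 0), (fun=> 0), 0, 0; split=> //; last by rewrite !trcons0 addr0.
by move=> z _; rewrite !mul0r addr0; exact: is_derive_cst.
Qed.

Lemma xsymb_lin N q F G s t : xsymb N F s -> xsymb N G t ->
  xsymb N (fun z => ratr q * F z + G z) (q *: s + t).
Proof.
elim: N F G s t => [|N IH] F G s t /=.
  move=> [q1 [F1 ->]] [q2 [G2 ->]]; exists (q * q1 + q2); split.
    by move=> z Uz; rewrite F1 // G2 // rmorphD rmorphM.
  by rewrite freegZU freegUD.
move=> [A [B [a [b [sA sB dF ->]]]]] [A' [B' [a' [b' [sA' sB' dG ->]]]]].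
exists (fun z => ratr q * A z + A' z), (fun z => ratr q * B z + B' z).
exists (q *: a + a'), (q *: b + b'); split; [exact: IH|exact: IH| |].
  move=> z Uz; have D := is_derive1_lin (ratr q) (dF z Uz) (dG z Uz).
  by apply: (is_derive_eq D); ring.
by rewrite !trconsD !trconsZ scalerDr addrACA.
Qed.

Lemma xsymbZ N q F s : xsymb N F s -> xsymb N (fun z => ratr q * F z) (q *: s).
Proof.
move=> sF; have := xsymb_lin q sF (xsymb0 N).
by rewrite addr0; under eq_fun do rewrite addr0.
Qed.

Lemma xsymbD N F G s t : xsymb N F s -> xsymb N G t ->
  xsymb N (fun z => F z + G z) (s + t).
Proof.
move=> sF sG; have := xsymb_lin 1 sF sG.
by rewrite scale1r; under eq_fun do rewrite rmorph1 mul1r.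
Qed.

Lemma xsymb_sum N a b (F : nat -> C -> C) (s : nat -> words) :
  (forall j, (a <= j < b)%N -> xsymb N (F j) (s j)) ->
  xsymb N (fun z => \sum_(a <= j < b) F j z) (\sum_(a <= j < b) s j).
Proof.
move=> H.
have {}H j : j \in index_iota a b -> xsymb N (F j) (s j) by rewrite mem_index_iota; exact: H.
elim: (index_iota a b) H => [|j r IH] H.
  by rewrite big_nil; under eq_fun do rewrite big_nil; exact: xsymb0.
rewrite big_cons; under eq_fun do rewrite big_cons.
apply: xsymbD; first by apply: H; rewrite mem_head.
by apply: IH => i ir; apply: H; rewrite in_cons ir orbT.
Qed.

(* Multiplication on the right by the combination [u.1 X + u.2 Y]. *)
Definition lop (u : rat * rat) s : words := trcons lz (u.1 *: s) + trcons lonem (u.2 *: s).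

Lemma lopZ u q s : lop u (q *: s) = q *: lop u s.
Proof. by rewrite /lop scalerDr -!trconsZ !scalerA ![q * _]mulrC. Qed.

(** * Symbols of S_{n,p} after a substitution whose dlogs are combinations of the two letters *)

Section Substitution.
Variables (phi dphi : C -> C) (u v : rat * rat).
Hypotheses (phi_cut : forall z, U z -> cut1 (phi z))
  (phi_neq0 : forall z, U z -> phi z != 0)
  (phi_derive : forall z, U z ->
    is_derive (z : C^o) 1 (phi : C^o -> C^o) (dphi z))
  (dlog_phi : forall z, U z -> dphi z / phi z =
     ratr u.1 * z^-1 + ratr u.2 * - (1 - z)^-1)
  (dlog_onem_phi : forall z, U z -> - dphi z / (1 - phi z) =
     ratr v.1 * z^-1 + ratr v.2 * - (1 - z)^-1).

(** Since S_{0,p+1}' = S_{0,p}/(1 - z), each step appends minus the dlog of 1 - phi, that is, minus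
    the combination [v]. *)
Lemma xsymb_nielsen0 p : xsymb p (fun z => nielsen 0 p (phi z))
  ((-1) ^+ p *: iter p (lop v) (word0 R)).
Proof.
elim: p => [|p IH].
  exists 1; split; last by rewrite /= expr0 scale1r.
  by move=> z _; rewrite /nielsen eqxx !expr0 fact0 mulr1 divr1 rmorph1.
have IHm q := xsymbZ (- q) IH.
exists (fun z => ratr (- v.1) * nielsen 0 p (phi z)),
  (fun z => ratr (- v.2) * nielsen 0 p (phi z)).
do 2!eexists; split; [exact: IHm|exact: IHm| |].
  move=> z Uz.
  have D := is_derive1_chain (nielsen0_derive p (phi_cut Uz)) (phi_derive Uz).
  apply: (is_derive_eq D).
  have -> : nielsen 0 p (phi z) / (1 - phi z) * dphi z =
      - nielsen 0 p (phi z) * (- dphi z / (1 - phi z)) by ring.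
  by rewrite dlog_onem_phi // !rmorphN; ring.
rewrite /= exprS mulN1r scaleNr -lopZ /lop !trconsZ.
by rewrite !scaleNr opprD.
Qed.

(** Raising n by one appends the dlog of phi, that is, the combination [u]. *)
Lemma xsymb_nielsen n p : xsymb (n + p.+1) (fun z => nielsen n p.+1 (phi z))
  ((-1) ^+ p.+1 *: iter n (lop u) (iter p.+1 (lop v) (word0 R))).
Proof.
elim: n => [|n IH]; first exact: xsymb_nielsen0.
have IHm q := xsymbZ q IH.
exists (fun z => ratr u.1 * nielsen n p.+1 (phi z)),
  (fun z => ratr u.2 * nielsen n p.+1 (phi z)).
do 2!eexists; split; [exact: IHm|exact: IHm| |].
  move=> z Uz.
  have D := is_derive1_chain (nielsen_derive n p (phi_cut Uz) (phi_neq0 Uz))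
    (phi_derive Uz).
  apply: (is_derive_eq D).
  have -> : nielsen n p.+1 (phi z) / phi z * dphi z =
      nielsen n p.+1 (phi z) * (dphi z / phi z) by ring.
  by rewrite dlog_phi //; ring.
by rewrite [iter n.+1 _ _]iterS -lopZ.
Qed.

End Substitution.

Lemma lop10 : lop (1, 0) = trcons lz.
Proof. by apply/funext => s; rewrite /lop scale1r scale0r trcons0 addr0. Qed.

Lemma lop01 : lop (0, 1) = trcons lonem.
Proof. by apply/funext => s; rewrite /lop scale1r scale0r trcons0 add0r. Qed.

Lemma lopN11 : lop (-1, 1) = rdiff lz lonem.
Proof. by apply/funext => s; rewrite /lop /rdiff scale1r trconsZ scaleN1r addrC. Qed.

Lemma lopN10 : lop (-1, 0) = fun s => - trcons lz s.
Proof. by apply/funext => s; rewrite /lop scale0r trcons0 addr0 trconsZ scaleN1r. Qed.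

Lemma xsymb_nielsen_id n p : xsymb (n + p.+1) (nielsen n p.+1)
  ((-1) ^+ p.+1 *: mono lonem lz p.+1 n).
Proof.
have H := @xsymb_nielsen id (fun=> 1) (1, 0) (0, 1).
rewrite lop10 lop01 in H.
have -> : mono lonem lz p.+1 n = iter n (trcons lz) (iter p.+1 (trcons lonem) (word0 R)).
  rewrite /mono [in RHS]iter_trcons_word0; elim: n => // n IH.
  by rewrite [iter n.+1 _ (word0 R)]iterS iter_tcons_trcons IH.
apply: H => z Uz; have [z0 z1 c1 c2 c3] := cut_planeP Uz => //=.
- by rewrite rmorph1 rmorph0; ring.
- by rewrite rmorph1 rmorph0; ring.
Qed.

Lemma xsymb_nielsen_onem n p : xsymb (n + p.+1) (fun z => nielsen n p.+1 (1 - z))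
  ((-1) ^+ p.+1 *: mono lz lonem p.+1 n).
Proof.
have H := @xsymb_nielsen (fun z => 1 - z) (fun=> -1) (0, 1) (1, 0).
rewrite lop10 lop01 in H.
have -> : mono lz lonem p.+1 n = iter n (trcons lonem) (iter p.+1 (trcons lz) (word0 R)).
  rewrite /mono [in RHS]iter_trcons_word0; elim: n => // n IH.
  by rewrite [iter n.+1 _ (word0 R)]iterS iter_tcons_trcons IH.
apply: H => z Uz; have [z0 z1 c1 c2 c3] := cut_planeP Uz => //=.
- exact: is_derive1_onem.
- by rewrite rmorph1 rmorph0; ring.
- by rewrite rmorph1 rmorph0 opprK opprB addrC subrK; ring.
Qed.

(** Here phi = -(1 - z)/z, whose constant -1 has no dlog, so [u] is Y - X. As 1 - phi = 1/z, [v] is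
    -X, and its signs cancel the prefactor (-1)^(p+1). *)
Lemma xsymb_nielsen_onem_inv n p :
  xsymb (n + p.+1) (fun z => nielsen n p.+1 (1 - z^-1)) (diff_mono lz lonem p.+1 n).
Proof.
have H := @xsymb_nielsen (fun z => 1 - z^-1) (fun z => z ^- 2) (-1, 1) (-1, 0).
rewrite lopN11 lopN10 in H.
have -> : diff_mono lz lonem p.+1 n =
    (-1) ^+ p.+1 *: iter n (rdiff lz lonem) (iter p.+1 (fun s => - trcons lz s) (word0 R)).
  have -> : iter p.+1 (fun s => - trcons lz s) (word0 R) =
      (-1) ^+ p.+1 *: iter p.+1 (tcons lz) (word0 R).
    rewrite -iter_trcons_word0; elim: p.+1 => [|k IH]; first by rewrite expr0 scale1r.
    by rewrite !iterS IH trconsZ exprS mulN1r scaleNr.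
  have -> (q : rat) s : iter n (rdiff lz lonem) (q *: s) = q *: iter n (rdiff lz lonem) s.
    by elim: n => // n IH; rewrite !iterS IH /rdiff !trconsZ scalerBr.
  rewrite scalerA -expr2 sqrr_sign scale1r /diff_mono.
  elim: n => // n IH.
  by rewrite [iter n.+1 _ (word0 R)]iterS iter_tcons_rdiff IH.
have rN1 : ratr (-1) = -1 :> C by rewrite rmorphN rmorph1.
apply: H => z Uz; have [z0 z1 c1 c2 c3] := cut_planeP Uz => //=.
- rewrite subr_eq0 eq_sym invr_eq1; apply: contraNneq z1 => ->.
  by rewrite subrr.
- exact: is_derive1_onem_inv.
- by rewrite rN1 rmorph1; field; rewrite z1 z0 -oppr_eq0 opprB z1.
- have -> : 1 - (1 - z^-1) = z^-1 by ring.
  by rewrite rN1 rmorph0; field; rewrite ?z0 ?z1.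
Qed.

End NielsenSymbols.

(** * Linearity of the extension to formal combinations of points *)

Section FormalExtension.
Variable R : realType.
Local Notation C := R[i].
Implicit Types (f : C -> C) (D : {freeg C / rat}).

(** The support of a sum can be smaller than the union of the supports, and points may coincide, as
    z and 1 - z do at z = 1/2. Summing over a common larger list makes linearity visible. *)
Lemma formal_ext_superset f D (r : seq C) : uniq r -> {subset dom D <= r} ->
  formal_ext f D = \sum_(x <- r) ratr (coeff x D) * f x.
Proof.
move=> ur Dr; rewrite [RHS](bigID (fun x => x \in dom D)) /=.
rewrite [X in _ + X]big1 ?addr0; last first.
  by move=> x xD; rewrite coeff_outdom // rmorph0 mul0r.
rewrite -big_filter; apply: perm_big; apply: uniq_perm; rewrite ?uniq_dom ?filter_uniq //.
move=> x; rewrite mem_filter; case xD: (x \in dom D) => //=.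
by rewrite Dr.
Qed.

Lemma formal_extD f D1 D2 : formal_ext f (D1 + D2) = formal_ext f D1 + formal_ext f D2.
Proof.
pose r := undup (dom D1 ++ dom D2).
have ur : uniq r := undup_uniq _.
rewrite !(@formal_ext_superset f _ r) //.
- by rewrite -big_split /=; apply: eq_bigr => x _; rewrite coeffD rmorphD mulrDl.
- by move=> x xD; rewrite mem_undup mem_cat xD orbT.
- by move=> x xD; rewrite mem_undup mem_cat xD.
- by move=> x /domD_subset; rewrite mem_undup.
Qed.

Lemma formal_extZ f q D : formal_ext f (q *: D) = ratr q * formal_ext f D.
Proof.
rewrite (@formal_ext_superset f _ (dom D)) ?uniq_dom //; last exact: domZ_subset.
by rewrite /formal_ext mulr_sumr; apply: eq_bigr => x _; rewrite coeffZ rmorphM mulrA.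
Qed.

Lemma formal_ext_pt f z : formal_ext f (pt z) = f z.
Proof. by rewrite /formal_ext domU1 big_seq1 coeffU eqxx mulr1 rmorph1 mul1r. Qed.

End FormalExtension.

Lemma signS j : (-1) ^+ (j + 1) = - (-1) ^+ j :> rat.
Proof. by rewrite addn1 exprS mulN1r. Qed.

(** With m = b+2 and j = i+1, the ratio is the weight j/(m-1) of identity (ii). *)
Lemma bin_ratio_left b i :
  'C(b + i.+1, i.+1)%:R * (i.+1%:R / b.+1%:R) = 'C(b.+1 + i, i)%:R :> rat.
Proof.
rewrite mulrA -natrM [('C(_, _) * _)%N]mulnC addnS -addSn mul_bin_left addnK natrM.
by rewrite mulrAC divff ?mul1r // pnatr_eq0.
Qed.

(** With m = b+2 and j = i+1, the ratio is the weight j/(m+j-2) of identity (iii). *)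
Lemma bin_ratio_diag b i :
  'C(b + i.+1, i.+1)%:R * (i.+1%:R / (b + i.+1)%:R) = 'C(b + i, i)%:R :> rat.
Proof.
rewrite mulrA -natrM [('C(_, _) * _)%N]mulnC addnS -mul_bin_diag natrM.
by rewrite mulrAC divff ?mul1r // pnatr_eq0.
Qed.

(** * The identities for Nielsen polylogarithms *)

Section Identities.
Variable R : realType.
Local Notation C := R[i].
Local Notation words := (words R).
Local Notation U := (@cut_plane R).
Local Notation lz := (lz R).
Local Notation lonem := (lonem R).

Lemma mod_products_eqI N (F G : C -> C) (s t : words) :
  xsymb N F s -> xsymb N G t -> mprod N s = mprod N t -> mod_products_eq U N F G.
Proof.
move=> sF sG st; exists s, t; split; [exact: xsymb_is_symb|exact: xsymb_is_symb|].
have -> : mod_products N s = mod_products N t by [].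
by rewrite /tensor_eq subrr; exact: multilin_rel0.
Qed.

(** Each coefficient lives twice, as the complex number [Q j] on functions and as the rational [q j]
    on words. *)
Lemma mod_products_eq_sum m N (F : C -> C) (G : nat -> C -> C) (s : words)
    (t : nat -> words) (q : nat -> rat) (Q : nat -> C) :
  (forall j, Q j = ratr (q j)) ->
  xsymb N F s -> (forall j, (1 <= j < m)%N -> xsymb N (G j) (t j)) ->
  mprod N s = \sum_(1 <= j < m) q j *: mprod N (t j) ->
  mod_products_eq U N F (fun z => \sum_(1 <= j < m) Q j * G j z).
Proof.
move=> Qq sF tG st; apply: (mod_products_eqI sF (t := \sum_(1 <= j < m) q j *: t j)).
  apply: xsymb_sum => j /tG tj; rewrite Qq; exact: xsymbZ.
by rewrite st mprod_sum; apply: eq_bigr => j _; rewrite mprodZ.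
Qed.

Definition symb_id n p : words := (-1) ^+ p *: mono lonem lz p n.
Definition symb_onem n p : words := (-1) ^+ p *: mono lz lonem p n.
Definition symb_onem_inv n p : words := diff_mono lz lonem p n.

Lemma xsymb_id N n p : (0 < p)%N -> (n + p)%N = N ->
  xsymb N (nielsen n p) (symb_id n p).
Proof. by case: p => // p _ <-; exact: xsymb_nielsen_id. Qed.

Lemma xsymb_onem N n p : (0 < p)%N -> (n + p)%N = N ->
  xsymb N (fun z => nielsen n p (1 - z)) (symb_onem n p).
Proof. by case: p => // p _ <-; exact: xsymb_nielsen_onem. Qed.

Lemma xsymb_onem_inv N n p : (0 < p)%N -> (n + p)%N = N ->
  xsymb N (fun z => nielsen n p (1 - z^-1)) (symb_onem_inv n p).
Proof. by case: p => // p _ <-; exact: xsymb_nielsen_onem_inv. Qed.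

(** The sign (-1)^p of the symbol meets (-1)^(n+p+1) from the reversal [emono_sym]. *)
Lemma mprod_symb_id N n p : (n + p)%N = N ->
  mprod N (symb_id n p) = (-1) ^+ n.+1 *: emono lz lonem n p.
Proof.
move=> <-; rewrite mprodZ addnC -/(emono lonem lz p n) emono_sym scalerA -exprD.
by congr (_ *: _); apply: eq_sign; lia.
Qed.

Lemma mprod_symb_onem N n p : (n + p)%N = N ->
  mprod N (symb_onem n p) = (-1) ^+ p *: emono lz lonem p n.
Proof. by move=> <-; rewrite mprodZ addnC. Qed.

Lemma mprod_symb_onem_inv N n p : (n + p)%N = N ->
  mprod N (symb_onem_inv n p) = ediff lz lonem p n.
Proof. by move=> <-; rewrite addnC. Qed.

Lemma ratr_sign_bin (a b c : nat) :
  (-1) ^+ a * 'C(b, c)%:R = ratr ((-1) ^+ a * 'C(b, c)%:R) :> C.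
Proof. by rewrite rmorphM rmorph_sign rmorph_nat. Qed.

Lemma nielsen_identity1 b : let S n p := formal_ext (@nielsen R n p) in
  let m := b.+1 in
  mod_products_eq U (2 * m + m)
    (fun z => S (2 * m)%N m (pt z + pt (1 - z) + pt (1 - z^-1)))
    (fun z => \sum_(1 <= j < m)
       (-1) ^+ (j + 1)%N * 'C(m - 1 + j, j)%:R *
       S (2 * m + j)%N (m - j)%N
         (pt z + pt (1 - z) + pt (1 - z^-1))).
Proof.
move=> S m.
pose w n p := symb_id n p + symb_onem n p + symb_onem_inv n p.
have wE N n p : (0 < p)%N -> (n + p)%N = N ->
    xsymb N (fun z => S n p (pt z + pt (1 - z) + pt (1 - z^-1))) (w n p).
  move=> p0 nN; rewrite /S.
  under eq_fun do rewrite !formal_extD !formal_ext_pt.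
  by apply: xsymbD; [apply: xsymbD|]; [exact: xsymb_id|exact: xsymb_onem|exact: xsymb_onem_inv].
apply: (mod_products_eq_sum (q := fun j => (-1) ^+ (j + 1) * 'C(m - 1 + j, j)%:R)
  (s := w (2 * m)%N m) (t := fun j => w (2 * m + j)%N (m - j)%N)).
- by move=> j; exact: ratr_sign_bin.
- exact: wE.
- by move=> j jm; apply: wE; lia.
have mprodw N n p : (n + p)%N = N -> mprod N (w n p) = (-1) ^+ n.+1 *: emono lz lonem n p
     + (-1) ^+ p *: emono lz lonem p n + ediff lz lonem p n.
  by move=> nN; rewrite !mprodD mprod_symb_id // mprod_symb_onem // mprod_symb_onem_inv.
(* The term j = 0, with coefficient 1, is the left-hand side of the identity. *)
have := mod_products_id1 lz lonem b; rewrite big_ltn // bin0 expr0 mulr1 scale1r.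
rewrite addn0 subn0 (_ : 2 * b + 2 = 2 * m)%N; last by rewrite /m; lia.
move/eqP; rewrite addr_eq0 => /eqP; rewrite mprodw // => ->.
rewrite -sumrN; apply: eq_big_nat => j jm; rewrite mprodw; last by lia.
by rewrite signS mulNr scaleNr /m subn1.
Qed.

(** The case m = 1 of (ii), outside the parametrization m = b+2. It is Euler's reflection formula
    for the dilogarithm S_{1,1}: the two terms give e(1, 1) with opposite signs. *)
Lemma nielsen_identity2_1 : let S n p := formal_ext (@nielsen R n p) in
  mod_products_eq U 2
    (fun z => S 1%N 1%N (pt z + pt (1 - z))) (fun=> 0).
Proof.
move=> S; apply: (mod_products_eqI (s := symb_id 1 1 + symb_onem 1 1) (t := 0)).
- rewrite /S; under eq_fun do rewrite !formal_extD !formal_ext_pt.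
  by apply: xsymbD; [exact: xsymb_id|exact: xsymb_onem].
- exact: xsymb0.
rewrite mprodD mprod_symb_id // mprod_symb_onem // -scalerDl sqrrN expr1n expr1 subrr scale0r.
by rewrite /mprod raddf0.
Qed.

Lemma nielsen_identity2 b : let S n p := formal_ext (@nielsen R n p) in
  let m := b.+2 in
  mod_products_eq U (2 * m - 1 + m)
    (fun z => S (2 * m - 1)%N m (pt z + pt (1 - z)))
    (fun z => \sum_(1 <= j < m)
       (-1) ^+ (j + 1)%N * 'C(m - 2 + j, j)%:R *
       S (2 * m - 1 + j)%N (m - j)%N
         (pt z + pt (1 - z) + (j%:R / (m - 1)%:R) *: pt (1 - z^-1))).
Proof.
move=> S m.
pose c j : rat := j%:R / (m - 1)%:R.
pose w n p := symb_id n p + symb_onem n p.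
have wE N n p : (0 < p)%N -> (n + p)%N = N ->
    xsymb N (fun z => S n p (pt z + pt (1 - z))) (w n p).
  move=> p0 nN; rewrite /S.
  under eq_fun do rewrite !formal_extD !formal_ext_pt.
  by apply: xsymbD; [exact: xsymb_id|exact: xsymb_onem].
apply: (mod_products_eq_sum (q := fun j => (-1) ^+ (j + 1) * 'C(m - 2 + j, j)%:R)
  (s := w (2 * m - 1)%N m)
  (t := fun j => w (2 * m - 1 + j)%N (m - j)%N +
                 c j *: symb_onem_inv (2 * m - 1 + j)%N (m - j)%N)).
- by move=> j; exact: ratr_sign_bin.
- exact: wE.
- move=> j jm; rewrite /S.
  under eq_fun do rewrite formal_extD formal_extZ formal_ext_pt.
  apply: xsymbD; first by apply: wE; lia.
  by apply: xsymbZ; apply: xsymb_onem_inv; lia.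
have mprodw N n p : (n + p)%N = N -> mprod N (w n p) =
    (-1) ^+ n.+1 *: emono lz lonem n p + (-1) ^+ p *: emono lz lonem p n.
  by move=> nN; rewrite !mprodD mprod_symb_id // mprod_symb_onem.
have := mod_products_id2 lz lonem b; rewrite big_ltn // bin0 expr0 mulr1 scale1r.
rewrite addn0 subn0 (_ : 2 * b + 3 = 2 * m - 1)%N; last by rewrite /m; lia.
rewrite mprodw // => /(canRL (addrK _)) ->.
have -> : \sum_(0 <= i < b.+1) ((-1) ^+ i * 'C(b.+1 + i, i)%:R) *:
      ediff lz lonem (b.+1 - i) (2 * b + 4 + i) =
    \sum_(1 <= j < m) ((-1) ^+ (j + 1) * 'C(b + j, j)%:R * c j) *:
      ediff lz lonem (m - j) (2 * m - 1 + j).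
  rewrite [RHS]big_add1 /=; apply: eq_big_nat => i ib; congr (_ *: ediff _ _ _ _).
  - by rewrite signS exprS mulN1r opprK -mulrA /c /m subn1 /= bin_ratio_left.
  - by rewrite /m; lia.
rewrite -sumrB; apply: eq_big_nat => j jm; rewrite mprodD mprodZ mprodw; last by lia.
rewrite mprod_symb_onem_inv; last by lia.
have -> : (m - 2 + j = b + j)%N by rewrite /m; lia.
by rewrite [RHS]scalerDr scalerA addrC signS !mulNr !scaleNr.
Qed.

Lemma nielsen_identity3 b : let S n p := formal_ext (@nielsen R n p) in
  let m := b.+2 in
  mod_products_eq U (2 * m - 2 + m)
    (fun z => S (2 * m - 2)%N m (pt z))
    (fun z => \sum_(1 <= j < m)
       (-1) ^+ (j + 1)%N * 'C(m - 2 + j, j)%:R *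
       S (2 * m - 2 + j)%N (m - j)%N
         (pt z - (j%:R / (m + j - 2)%:R) *: pt (1 - z)
          - (j%:R / (m + j - 2)%:R) *: pt (1 - z^-1))).
Proof.
move=> S m.
pose c j : rat := j%:R / (m + j - 2)%:R.
apply: (mod_products_eq_sum (q := fun j => (-1) ^+ (j + 1) * 'C(m - 2 + j, j)%:R)
  (s := symb_id (2 * m - 2)%N m)
  (t := fun j => symb_id (2 * m - 2 + j)%N (m - j)%N +
                 (- c j) *: (symb_onem (2 * m - 2 + j)%N (m - j)%N +
                             symb_onem_inv (2 * m - 2 + j)%N (m - j)%N))).
- by move=> j; exact: ratr_sign_bin.
- rewrite /S; under eq_fun do rewrite formal_ext_pt.
  exact: xsymb_id.
- move=> j jm; rewrite /S.
  (* Both subtracted points carry the same weight, so they are grouped as one rational multiple. *)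
  under eq_fun do rewrite -addrA -opprD -scalerDr -scaleNr formal_extD formal_extZ
    formal_extD !formal_ext_pt.
  apply: xsymbD; first by apply: xsymb_id; lia.
  apply: xsymbZ; apply: xsymbD; first by apply: xsymb_onem; lia.
  by apply: xsymb_onem_inv; lia.
have := mod_products_id3 lz lonem b; rewrite big_ltn // bin0 expr0 mulr1 scale1r.
rewrite addn0 subn0 (_ : 2 * b + 2 = 2 * m - 2)%N; last by rewrite /m; lia.
rewrite mprod_symb_id // -addrA => /eqP; rewrite addr_eq0 => /eqP ->.
have -> : \sum_(0 <= i < b.+1) ((-1) ^+ i * 'C(b + i, i)%:R) *:
      ((-1) ^+ (b.+1 - i) *: emono lz lonem (b.+1 - i) (2 * b + 3 + i)
       + ediff lz lonem (b.+1 - i) (2 * b + 3 + i)) =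
    \sum_(1 <= j < m) ((-1) ^+ (j + 1) * 'C(b + j, j)%:R * c j) *:
      ((-1) ^+ (m - j) *: emono lz lonem (m - j) (2 * m - 2 + j)
       + ediff lz lonem (m - j) (2 * m - 2 + j)).
  rewrite [RHS]big_add1 /=; apply: eq_big_nat => i ib.
  have -> : (2 * m - 2 + i.+1 = 2 * b + 3 + i)%N by rewrite /m; lia.
  rewrite /m subSS; congr (_ *: _).
  rewrite signS exprS mulN1r opprK -mulrA /c /m.
  have -> : (b.+2 + i.+1 - 2 = b + i.+1)%N by lia.
  by rewrite bin_ratio_diag.
rewrite -big_split -sumrN; apply: eq_big_nat => j jm.
rewrite mprodD [mprod _ (- c j *: _)]mprodZ [mprod _ (symb_onem _ _ + _)]mprodD.
rewrite mprod_symb_id; last by lia.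
rewrite mprod_symb_onem; last by lia.
rewrite mprod_symb_onem_inv; last by lia.
have -> : (m - 2 + j = b + j)%N by rewrite /m; lia.
by rewrite [RHS]scalerDr opprD signS !mulNr !scaleNr scalerN !opprK !scalerA.
Qed.

End Identities.

Theorem theorem10p1 (R : realType) (m : nat) (hm : (1 <= m)%N) :
  let S n p := formal_ext (@nielsen R n p) in
  let U := @cut_plane R in
  [/\ mod_products_eq U (2 * m + m)
        (fun z => S (2 * m)%N m (pt z + pt (1 - z) + pt (1 - z^-1)))
        (fun z => \sum_(1 <= j < m)
           (-1) ^+ (j + 1)%N * 'C(m - 1 + j, j)%:R *
           S (2 * m + j)%N (m - j)%N
             (pt z + pt (1 - z) + pt (1 - z^-1))),
      mod_products_eq U (2 * m - 1 + m)
        (fun z => S (2 * m - 1)%N m (pt z + pt (1 - z)))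
        (fun z => \sum_(1 <= j < m)
           (-1) ^+ (j + 1)%N * 'C(m - 2 + j, j)%:R *
           S (2 * m - 1 + j)%N (m - j)%N
             (pt z + pt (1 - z)
              + (j%:R / (m - 1)%:R) *: pt (1 - z^-1))) &
      (2 <= m)%N ->
      mod_products_eq U (2 * m - 2 + m)
        (fun z => S (2 * m - 2)%N m (pt z))
        (fun z => \sum_(1 <= j < m)
           (-1) ^+ (j + 1)%N * 'C(m - 2 + j, j)%:R *
           S (2 * m - 2 + j)%N (m - j)%N
             (pt z - (j%:R / (m + j - 2)%:R) *: pt (1 - z)
              - (j%:R / (m + j - 2)%:R) *: pt (1 - z^-1)))].
Proof.
move=> S U; split.
- by case: m hm => // b _; exact: nielsen_identity1.
(* At m = 1 the sum on the right is empty, so the claim is equality with 0. *)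
- case: m hm => // -[_|b _]; last exact: nielsen_identity2.
  have := nielsen_identity2_1 R; rewrite /= -/S.
  by under [X in _ -> mod_products_eq _ _ _ X]eq_fun do rewrite big_geq //.
- by case: m hm => // -[|b] // _ _; exact: nielsen_identity3.
Qed.
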